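(* Consider the capped stationary call-side problem. (i) Assume that $q>0$, or that $q=0$ and $K_1+k_1<K_2$, let $b$ and $V^\infty$ be the uncapped upper boundary and the uncapped stationary function defined in the context, and suppose that $b\le\ln k_1$. Then the restriction of $V^\infty$ to $(-\infty,\ln k_1]$ is the unique strong solution of the capped stationary call-side problem. (ii) Suppose that $q=0$ and $K_1+k_1\ge K_2$, or that ($q>0$, or $q=0$ and $K_1+k_1<K_2$) and $b>\ln k_1$. Let $y>1$ be the unique solution in $(1,\infty)$ of $g(y)=0$, where $$g(z)=\frac{K_2-k_1}{n_2-n_1}\left[n_2z^{n_1}-n_1z^{n_2}\right]-(K_2-K_1),$$ and let $e^a=k_1/y$. Then the unique strong solution of the capped stationary call-side problem is $$V(x)=\begin{cases}K_2-k_1,&x<a,\\[2pt] \dfrac{K_2-k_1}{n_2-n_1}\left[n_2e^{n_1(x-a)}-n_1e^{n_2(x-a)}\right],&a\le x\le\ln k_1,\end{cases}$$ and its coincidence set $\{V=\psi_1\}$ is $(-\infty,a]\cup\{\ln k_1\}$.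
   Context: Constants: $0<K_1<k_1<k_2<K_2$, $\sigma>0$, $r>0$, $q\ge0$, and $1<p<\infty$. Put $\mathcal Lu:=\frac{\sigma^2}{2}u''+\left(r-q-\frac{\sigma^2}{2}\right)u'-ru$ and $\psi_1(x):=(e^x-K_1)^++K_2-k_1$. $n_1<0<n_2$ denote the roots of $\frac{\sigma^2}{2}n^2+\left(r-q-\frac{\sigma^2}{2}\right)n-r=0$. A strong solution of the capped stationary call-side problem is a bounded function $V\in C((-\infty,\ln k_1])\cap W^2_{p,\mathrm{loc}}((-\infty,\ln k_1))$ with $V\ge\psi_1$, $-\mathcal LV\ge0$ almost everywhere, $-\mathcal LV=0$ almost everywhere on $\{V>\psi_1\}$, and $V(\ln k_1)=K_2-K_1$. Uncapped data, defined when $q>0$, or $q=0$ and $K_1+k_1<K_2$: let $y_\infty>1$ be the unique root in $(1,\infty)$ of $f(z)=\frac{K_2-k_1}{n_2-n_1}\left[n_2(1-n_1)z^{n_1}+n_1(n_2-1)z^{n_2}\right]+(K_1+k_1-K_2)$, let $e^b=\frac{(K_2-k_1)n_1n_2}{n_2-n_1}\left[y_\infty^{n_1}-y_\infty^{n_2}\right]$, $e^{a^\infty}=e^b/y_\infty$, and let $V^\infty(x)=K_2-k_1$ for $x<a^\infty$, $V^\infty(x)=\frac{K_2-k_1}{n_2-n_1}\left[n_2e^{n_1(x-a^\infty)}-n_1e^{n_2(x-a^\infty)}\right]$ for $a^\infty\le x\le b$, and $V^\infty(x)=e^x-K_1+K_2-k_1$ for $x>b$. *)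

(* Defs.v *)
From mathcomp Require Export all_boot all_order all_algebra.
From mathcomp Require Export all_classical all_reals all_analysis.
Export Order.TTheory GRing.Theory Num.Theory.
Export numFieldNormedType.Exports.

Set Implicit Arguments.
Unset Strict Implicit.
Unset Printing Implicit Defensive.

Local Open Scope classical_set_scope.
Local Open Scope ring_scope.

Section sobolev_space_on_the_line.
Context {R : realType}.
Notation mu := (@lebesgue_measure R).
Implicit Types (Omega K : set R) (u v phi : R -> R).

(* C_c^oo(Omega) *)
Definition test_function Omega phi :=
  (forall n x, derivable (phi^`(n))%classic x 1) /\
  exists K, [/\ compact K, K `<=` Omega & forall x, ~ K x -> phi x = 0].

Definition Lp_loc Omega (p : R) u :=
  forall K, compact K -> K `<=` Omega -> u \_ K \in Lfun mu p%:E.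

Definition weak_derivative Omega (n : nat) u v :=
  forall phi, test_function Omega phi ->
    \int[mu]_(x in Omega) (u x * (phi^`(n))%classic x) =
    (- 1) ^+ n * \int[mu]_(x in Omega) (v x * phi x).

(* u belongs to W^2_{p,loc}(Omega), with weak derivatives u' = u1 and
   u'' = u2; these are determined by u up to a null set. *)
Definition W2p_loc Omega (p : R) u u1 u2 :=
  [/\ Lp_loc Omega p u, Lp_loc Omega p u1, Lp_loc Omega p u2,
      weak_derivative Omega 1 u u1 & weak_derivative Omega 2 u u2].

End sobolev_space_on_the_line.

Section capped_problem.
Context {R : realType}.
Variables (sigma r q p K1 k1 K2 : R).
Notation mu := (@lebesgue_measure R).

Definition char_poly2 (n : R) : R :=
  sigma ^+ 2 / 2 * n ^+ 2 + (r - q - sigma ^+ 2 / 2) * n - r.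

(* L u (x) as a function of the values u(x), u'(x), u''(x) *)
Definition Lop (u u1 u2 : R) : R :=
  sigma ^+ 2 / 2 * u2 + (r - q - sigma ^+ 2 / 2) * u1 - r * u.

Definition psi1 (x : R) : R := Num.max (expR x - K1) 0 + K2 - k1.

(* Only the values of V on ]-oo, ln k1] are constrained. *)
Definition strong_solution (V : R -> R) :=
  [/\ [bounded V x | x in `]-oo, ln k1]%classic],
      {within `]-oo, ln k1], continuous V},
      V (ln k1) = K2 - K1,
      (forall x, x <= ln k1 -> psi1 x <= V x) &
      exists V1 V2 : R -> R,
        [/\ W2p_loc `]-oo, ln k1[ p V V1 V2,
            \forall x \ae mu, x < ln k1 -> 0 <= - Lop (V x) (V1 x) (V2 x) &
            \forall x \ae mu, x < ln k1 -> psi1 x < V x ->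
              - Lop (V x) (V1 x) (V2 x) = 0]].

(* Uniqueness is as functions on ]-oo, ln k1]. *)
Definition unique_strong_solution (V : R -> R) :=
  strong_solution V /\
  forall W, strong_solution W -> forall x, x <= ln k1 -> W x = V x.

Definition coincidence_set (V : R -> R) : set R :=
  [set x | x <= ln k1 /\ V x = psi1 x].

Variables (n1 n2 : R).

Definition unique_root_gt1 (h : R -> R) (y : R) :=
  unique (fun z => 1 < z /\ h z = 0) y.

(* (K2 - k1) / (n2 - n1) * [n2 e^(n1 (x - a)) - n1 e^(n2 (x - a))] *)
Definition free_profile (a x : R) : R :=
  (K2 - k1) / (n2 - n1) *
  (n2 * expR (n1 * (x - a)) - n1 * expR (n2 * (x - a))).

Definition uncapped_defined := 0 < q \/ (q = 0 /\ K1 + k1 < K2).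

Definition f_uncapped (z : R) : R :=
  (K2 - k1) / (n2 - n1) *
  (n2 * (1 - n1) * z `^ n1 + n1 * (n2 - 1) * z `^ n2) + (K1 + k1 - K2).

(* In the next three definitions yinf is meant to be the root of f_uncapped
   in ]1, +oo[; the argument of ln is then positive. *)
Definition b_uncapped (yinf : R) : R :=
  ln ((K2 - k1) * n1 * n2 / (n2 - n1) * (yinf `^ n1 - yinf `^ n2)).

Definition a_uncapped (yinf : R) : R := ln (expR (b_uncapped yinf) / yinf).

Definition V_uncapped (yinf x : R) : R :=
  if x < a_uncapped yinf then K2 - k1
  else if x <= b_uncapped yinf then free_profile (a_uncapped yinf) x
  else expR x - K1 + K2 - k1.

Definition g_capped (z : R) : R :=
  (K2 - k1) / (n2 - n1) * (n2 * z `^ n1 - n1 * z `^ n2) - (K2 - K1).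

Definition a_capped (y : R) : R := ln (k1 / y).

Definition V_capped (y x : R) : R :=
  if x < a_capped y then K2 - k1 else free_profile (a_capped y) x.

End capped_problem.

(* Main.v *)
Require Import Defs.
From mathcomp Require Import measurable_realfun ring lra.

(* Write the differential operator as (sigma^2/2)(D - n1)(D - n2).

   Uniqueness. Where one strong solution V exceeds another one W the obstacle is
   inactive for V, so w = V - W is a distributional subsolution there. If w were
   positive somewhere, w(x) e^(-n1 x / 2) would attain a positive maximum at some
   xs < ln k1. Testing against the mollified Green function phi of an interval
   [xs - d, xs + d], for which the adjoint operator gives a bump at xs - d, minus
   a bump at xs, plus a bump at xs + d, yields the mean value inequality
   w(xs) <= B w(xs - d) + C w(xs + d) up to mollification, where B and C are the
   weights for which e^(n1 x) and e^(n2 x) satisfy it with equality. Since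
   n1 < n1/2 < n2, the function e^(n1 x / 2) satisfies it strictly the other way,
   a contradiction. Only integrals of w against test functions are needed, never
   a continuous representative of its derivative.

   Existence. The candidate is glued from K2 - k1, the profile F and the payoff
   line, with smooth fit, so its weak derivatives are the piecewise classical ones.
   As a function of e^x the profile is strictly convex, so to the left of a point
   where it meets the payoff line with at most the slope of that line it lies
   above the line; this yields both e^a < K1 and V >= psi1. *)

Set Implicit Arguments.
Unset Strict Implicit.
Unset Printing Implicit Defensive.

Local Open Scope classical_set_scope.
Local Open Scope ring_scope.

(** * Smooth functions and bumps *)

Section smooth.
Context {R : realType}.
Implicit Types (f g df dg : R -> R) (n : nat) (x : R).

(** Derivatives are given as explicit functions, so closure under sums and products follows by
    induction on [n]; [smoothP] translates to the iterated [derive1n] used for test functions. *)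
Fixpoint Cn n f : Prop :=
  if n is m.+1 then
    exists2 df, (forall x, is_derive x 1 f (df x)) & Cn m df
  else True.

Definition smooth f := forall n, Cn n f.

Lemma is_derive_unique x f a b :
  is_derive x 1 f a -> is_derive x 1 f b -> a = b.
Proof. by move=> fa fb; rewrite -(@derive_val _ _ _ _ _ _ _ fa) (@derive_val _ _ _ _ _ _ _ fb). Qed.

Lemma is_derive_add f g x a b : is_derive x 1 f a -> is_derive x 1 g b ->
  is_derive x 1 (fun y => f y + g y) (a + b).
Proof. by move=> fa gb; exact: is_deriveD. Qed.

Lemma is_derive_mul f g x a b : is_derive x 1 f a -> is_derive x 1 g b ->
  is_derive x 1 (fun y => f y * g y) (a * g x + f x * b).
Proof.
move=> fa gb; apply: (is_derive_eq (is_deriveM fa gb)).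
by rewrite addrC; congr (_ + _); exact: mulrC.
Qed.

Lemma is_derive_scale k f x a : is_derive x 1 f a ->
  is_derive x 1 (fun y => k * f y) (k * a).
Proof.
move=> fa; apply: (is_derive_eq (is_derive_mul (is_derive_cst k x 1) fa)).
by rewrite mul0r add0r.
Qed.

Lemma is_derive_sub f g x a b : is_derive x 1 f a -> is_derive x 1 g b ->
  is_derive x 1 (fun y => f y - g y) (a - b).
Proof. by move=> fa gb; exact: is_deriveB. Qed.

Lemma is_derive_continuous f df :
  (forall x, is_derive x 1 f (df x)) -> continuous f.
Proof.
move=> fdf x; apply: differentiable_continuous; apply/derivable1_diffP.
by have [] := fdf x.
Qed.

Lemma CnW n f : Cn n.+1 f -> Cn n f.
Proof.
elim: n f => // n IH f [df fdf Cdf]; exists df => //; exact: IH.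
Qed.

Lemma smooth_antiderivative f df :
  (forall x, is_derive x 1 f (df x)) -> smooth df -> smooth f.
Proof. by move=> fdf sdf [//|n]; exists df. Qed.

Lemma smooth_is_derive f df :
  smooth f -> (forall x, is_derive x 1 f (df x)) -> smooth df.
Proof.
move=> sf fdf n; have [df' fdf' Cdf'] := sf n.+1.
suff -> : df = df' by [].
by apply/funext => x; apply: is_derive_unique (fdf x) (fdf' x).
Qed.

Lemma smooth_derive1 f : smooth f -> forall x, is_derive x 1 f (derive1 f x).
Proof.
move=> sf x; have [df fdf _] := sf 1%N.
by rewrite derive1E; apply/derivableP; have [] := fdf x.
Qed.

Lemma smooth_derive1_smooth f : smooth f -> smooth (derive1 f).
Proof. by move=> sf; exact: smooth_is_derive (smooth_derive1 sf). Qed.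

Lemma smooth_continuous f : smooth f -> continuous f.
Proof. by move=> /smooth_derive1/is_derive_continuous. Qed.

Lemma smooth_derive1n f n : smooth f -> smooth (derive1n n f).
Proof. by move=> sf; elim: n => // n IH; rewrite derive1nS; exact: smooth_derive1_smooth. Qed.

Lemma smoothP f : smooth f <-> forall n x, derivable (derive1n n f) x 1.
Proof.
split=> [sf n x|df n].
  by have [] := smooth_derive1 (smooth_derive1n n sf) x.
elim: n f df => // n IH f df; exists (derive1 f); last first.
  by apply: IH => m x; rewrite -derive1Sn.
by move=> x; rewrite derive1E; apply/derivableP/(df 0%N).
Qed.

Lemma Cn_cst n (k : R) : Cn n (cst k).
Proof. by elim: n k => // n IH k; exists (cst 0) => // x; exact: is_derive_cst. Qed.

Lemma CnD n f g : Cn n f -> Cn n g -> Cn n (f \+ g).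
Proof.
elim: n f g => // n IH f g [df fdf Cdf] [dg gdg Cdg].
by exists (df \+ dg) => [x|]; [exact: is_deriveD|exact: IH].
Qed.

Lemma CnM n f g : Cn n f -> Cn n g -> Cn n (f \* g).
Proof.
elim: n f g => // n IH f g Cf Cg.
have [df fdf Cdf] := Cf; have [dg gdg Cdg] := Cg.
exists ((df \* g) \+ (f \* dg)) => [x|].
  apply: is_derive_eq; rewrite /= addrC; congr (_ + _); rewrite //.
  by rewrite mulrC.
by apply: CnD; apply: IH => //; exact: CnW.
Qed.

Lemma smooth_cst (k : R) : smooth (cst k).
Proof. by move=> n; exact: Cn_cst. Qed.

Lemma smoothD f g : smooth f -> smooth g -> smooth (fun x => f x + g x).
Proof. by move=> sf sg n; exact: CnD. Qed.

Lemma smoothM f g : smooth f -> smooth g -> smooth (fun x => f x * g x).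
Proof. by move=> sf sg n; exact: CnM. Qed.

Lemma smoothZ (k : R) f : smooth f -> smooth (fun x => k * f x).
Proof. by move=> sf; apply: smoothM => //; exact: smooth_cst. Qed.

Lemma smoothB f g : smooth f -> smooth g -> smooth (fun x => f x - g x).
Proof.
move=> sf sg; apply: smoothD => //.
by under eq_fun do rewrite -mulN1r; exact: smoothZ.
Qed.

Lemma is_derive_comp_affine (k l : R) f df x :
  is_derive (k * x + l) 1 f (df (k * x + l)) ->
  is_derive x 1 (fun y => f (k * y + l)) (k * df (k * x + l)).
Proof.
move=> fdf.
have H : is_derive x 1 (fun y => k * y + l) k.
  by apply: is_derive_eq; rewrite addr0 -[RHS]mulr1.
rewrite mulrC.
exact: (@is_derive1_comp _ f (fun y => k * y + l) x _ _ fdf H).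
Qed.

Lemma smooth_comp_affine (k l : R) f : smooth f -> smooth (fun x => f (k * x + l)).
Proof.
move=> sf n; elim: n f sf => // n IH f sf.
exists (fun x => k * derive1 f (k * x + l)) => [x|].
  exact: (is_derive_comp_affine (smooth_derive1 sf _)).
apply: CnM; first exact: Cn_cst.
exact/IH/smooth_derive1_smooth.
Qed.

Lemma smooth_translate (l : R) f : smooth f -> smooth (fun x => f (x - l)).
Proof.
by move=> /(smooth_comp_affine 1 (- l)); under eq_fun do rewrite mul1r.
Qed.

Lemma is_derive_translate (l : R) f df :
  (forall x, is_derive x 1 f (df x)) ->
  forall x, is_derive x 1 (fun y => f (y - l)) (df (x - l)).
Proof.
move=> fdf x.
have := @is_derive_comp_affine 1 (- l) f df x (fdf _).
by under eq_fun do rewrite mul1r; rewrite !mul1r.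
Qed.

Lemma is_derive_expRM (k x : R) :
  is_derive x 1 (fun y => expR (k * y)) (k * expR (k * x)).
Proof.
have := @is_derive_comp_affine k 0 expR expR x (is_derive_expR _).
by under eq_fun do rewrite addr0; rewrite addr0.
Qed.

Lemma smooth_expRM (k : R) : smooth (fun x => expR (k * x)).
Proof.
move=> n; elim: n => // n IH; exists (fun x => k * expR (k * x)).
  exact: is_derive_expRM.
by apply: CnM => //; exact: Cn_cst.
Qed.

End smooth.

Section bump.
Context {R : realType}.

(** The classical function e^(-1/x), flat at 0, multiplied by x^(-k): the extra power makes the
    family closed under differentiation up to linear combinations. *)
Definition flat (k : nat) (x : R) : R :=
  if 0 < x then x^-1 ^+ k * expR (- x^-1) else 0.

Lemma flat_ge0 k x : 0 <= flat k x.
Proof.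
rewrite /flat; case: ifPn => // x0.
by rewrite mulr_ge0 ?expR_ge0// exprn_ge0// invr_ge0 ltW.
Qed.

(** One term of the exponential series, e^s >= s^(k+2) / (k+2)! at s = 1/x, beats the power x^(-k)
    by two orders. *)
Lemma flat_le k (x : R) : flat k x <= (k.+2)`!%:R * x ^+ 2.
Proof.
rewrite /flat; case: ifPn => [x0|_]; last by rewrite mulr_ge0// sqr_ge0.
have F0 : (0 : R) < (k.+2)`!%:R by rewrite ltr0n fact_gt0.
have t0 : 0 < x^-1 by rewrite invr_gt0.
rewrite expRN ler_pdivrMr ?expR_gt0//.
have := @expR_ge1Dxn R x^-1 k.+1 (ltW t0).
move=> /(le_trans (_ : x^-1 ^+ k.+2 / (k.+2)`!%:R <= _)) => /(_ _)/wrap[].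
  by rewrite lerDr.
rewrite ler_pdivrMr// => H.
have -> : x^-1 ^+ k = x ^+ 2 * x^-1 ^+ k.+2.
  by rewrite !exprS expr0; field; exact: lt0r_neq0.
rewrite [leRHS](_ : _ = x ^+ 2 * (expR x^-1 * k.+2`!%:R)); last by ring.
by rewrite ler_wpM2l ?sqr_ge0.
Qed.

Lemma is_derive_flat k (x : R) :
  is_derive x 1 (flat k) (flat k.+2 x - k%:R * flat k.+1 x).
Proof.
have [x0|x0|->] := ltgtP x 0.
- have -> : flat k.+2 x - k%:R * flat k.+1 x = 0.
    by rewrite /flat !ltNge (ltW x0) /= mulr0 subrr.
  apply: (@near_eq_is_derive _ _ _ (cst 0)) => //.
  near=> y; rewrite /flat ltNge (_ : y <= 0)//.
  by near: y; apply: filterS (lt_nbhsl x0) => y /ltW.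
- have -> : flat k.+2 x - k%:R * flat k.+1 x =
      x^-1 ^+ k * ((x ^- 2) * expR (- x^-1)) +
        (k%:R * x^-1 ^+ k.-1 * - x ^- 2) * expR (- x^-1).
    rewrite /flat x0; case: k => [|k]; rewrite /= ?exprS ?expr0; field; exact: lt0r_neq0.
  apply: (@near_eq_is_derive _ R R (fun y : R => y^-1 ^+ k * expR (- y^-1))).
    near=> y; rewrite /flat ifT//.
    by near: y; exact: lt_nbhsr.
  have dV : is_derive x 1 (fun y : R => y^-1) (- x ^- 2).
    apply: is_derive_eq; first by apply: is_deriveV; exact: lt0r_neq0.
    by rewrite -[RHS]mulr1.
  have dX : is_derive x 1 (fun y : R => y^-1 ^+ k) (k%:R * x^-1 ^+ k.-1 * - x ^- 2).
    have := @is_deriveX _ _ (fun y : R => y^-1) k x 1 _ dV.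
    rewrite (_ : (fun y : R => y^-1) ^+ k = fun y => y^-1 ^+ k); last first.
      by apply/funext => y; rewrite fctE.
    by rewrite -mulr_natl.
  have dE : is_derive x 1 (fun y : R => expR (- y^-1)) (x ^- 2 * expR (- x^-1)).
    have := @is_derive1_comp _ expR (fun y => - y^-1) x _ _ (is_derive_expR _) (is_deriveN dV).
    by rewrite opprK mulrC.
  have H := is_deriveM dX dE; apply: (is_derive_eq H).
  by congr (_ + _); exact: mulrC.
- have -> : flat k.+2 0 - k%:R * flat k.+1 0 = 0.
    by rewrite /flat ltxx mulr0 subrr.
  (* By [flat_le] the difference quotient at 0 is at most a constant times |z|; the convention that
     the inverse of 0 is 0 gives it the value 0 there. *)
  apply/is_derive1_caratheodory; exists (fun z => flat k z / z); split.
  + move=> z; rewrite subr0 {2}/flat ltxx subr0.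
    have [->|z0] := eqVneq z 0; first by rewrite /flat ltxx mul0r mul0r.
    by rewrite divfK.
  + rewrite /prop_for /continuous_at /= invr0 mulr0.
    apply: (@squeeze_cvgr _ _ _ _ (fun z => - (k.+2`!%:R * `|z|)) (fun z => k.+2`!%:R * `|z|)).
    * near=> z; rewrite -ler_norml normrM (ger0_norm (flat_ge0 _ _)) normfV.
      have [->|z0] := eqVneq z 0; first by rewrite normr0 invr0 mulr0.
      by rewrite ler_pdivrMr ?normr_gt0// -mulrA -expr2 real_normK ?num_real// flat_le.
    * have : - (k.+2`!%:R * `|z|) @[z --> (0 : R)] --> - (k.+2`!%:R * `|0 : R|).
        by apply: cvgN; apply: cvgM; [exact: cvg_cst|exact: cvg_norm].
      by rewrite normr0 mulr0 oppr0.
    * have : (k.+2`!%:R * `|z|) @[z --> (0 : R)] --> (k.+2`!%:R * `|0 : R|).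
        by apply: cvgM; [exact: cvg_cst|exact: cvg_norm].
      by rewrite normr0 mulr0.
  + by rewrite invr0 mulr0.
Unshelve. all: by end_near. Qed.

Lemma smooth_flat k : smooth (flat k).
Proof.
move=> n; elim: n k => // n IH k.
exists (fun x => flat k.+2 x - k%:R * flat k.+1 x); first exact: is_derive_flat.
apply: CnD => //; under eq_fun do rewrite -mulN1r mulrA.
by apply: CnM => //; exact: Cn_cst.
Qed.

Definition bump (eta x : R) : R := flat 0 (x + eta) * flat 0 (eta - x).

Lemma bump_ge0 eta x : 0 <= bump eta x.
Proof. by rewrite mulr_ge0 ?flat_ge0. Qed.

Lemma bump_gt0 eta x : - eta < x < eta -> 0 < bump eta x.
Proof.
move=> /andP[ex xe]; rewrite /bump /flat !ifT ?subr_gt0 -?ltrBlDr ?sub0r//.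
by rewrite !expr0 !mul1r mulr_gt0 ?expR_gt0.
Qed.

Lemma bump_eq0 eta x : ~~ (- eta < x < eta) -> bump eta x = 0.
Proof.
rewrite negb_and -!leNgt => /orP[xe|ex]; rewrite /bump /flat.
  by rewrite ltNge -lerBrDr sub0r xe mul0r.
by rewrite [in X in _ * X]ltNge subr_le0 ex mulr0.
Qed.

Lemma smooth_bump eta : smooth (bump eta).
Proof.
apply: smoothM.
  have := smooth_translate (- eta) (smooth_flat 0).
  by under eq_fun do rewrite opprK.
have := smooth_comp_affine (-1) eta (smooth_flat 0).
by under eq_fun do rewrite mulN1r addrC.
Qed.

End bump.

(** * Integrals over intervals and primitives *)

Section integration.
Context {R : realType}.
Notation mu := (@lebesgue_measure R).
Implicit Types (f F : R -> R) (x : R).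

Lemma Rintegral_support (D E : set R) f : E `<=` D ->
  (forall x, D x -> ~ E x -> f x = 0) ->
  \int[mu]_(x in D) f x = \int[mu]_(x in E) f x.
Proof.
move=> ED f0; rewrite Rintegral_mkcond [RHS]Rintegral_mkcond.
apply: eq_Rintegral => x _; rewrite !patchE.
case: ifPn => [/set_mem Dx|/negP/(contra_not mem_set) Dx].
  by case: ifPn => // /negP/(contra_not mem_set); exact: f0.
by rewrite memNset// => /ED.
Qed.

Lemma Rintegral_FTC F f (a b : R) : (forall x, is_derive x 1 F (f x)) ->
  continuous f -> a <= b -> \int[mu]_(x in `[a, b]) f x = F b - F a.
Proof.
move=> Ff cf; rewrite le_eqVlt => /predU1P[->|ab].
  by rewrite set_itv1 Rintegral_set1 subrr.
have cF := is_derive_continuous Ff.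
rewrite /Rintegral (@continuous_FTC2 _ f F)//.
- exact: continuous_subspaceT.
- split=> [x _||]; first by have [] := Ff x.
  + by apply: cvg_at_right_filter; exact: cF.
  + by apply: cvg_at_left_filter; exact: cF.
- by move=> x _; rewrite derive1E; apply: derive_val.
Qed.

(** The primitive is the integral from -oo: the zero left tail makes [f] integrable on every
    half-line ]-oo, u] and makes the primitive vanish left of [l]. *)
Lemma antiderivative_ex f (l : R) : continuous f ->
  (forall x, x <= l -> f x = 0) ->
  exists2 F, (forall x, is_derive x 1 F (f x)) & forall x, x <= l -> F x = 0.
Proof.
move=> cf f0; pose F x := \int[mu]_(t in `]-oo, x]) f t.
have intf u : mu.-integrable `]-oo, u] (EFin \o f).
  have -> : EFin \o f = (EFin \o f) \_ `[l, +oo[.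
    apply/funext => x; rewrite patchE; case: ifPn => //.
    rewrite notin_setE/= in_itv/= andbT => /negP; rewrite -ltNge => xl.
    by rewrite f0// ltW.
  apply/integrable_restrict => //.
  apply: (@integrableS _ _ _ mu `[l, u]%classic) => //.
  - by apply: measurableI.
  - by move=> x/= []; rewrite !in_itv/= andbT => -> ->.
  - apply: continuous_compact_integrable; first exact: segment_compact.
    exact: continuous_subspaceT.
exists F => x.
  have x1 : x < x + 1 by rewrite ltrDl.
  have [dF Ff] := @continuous_FTC1 R f -oo%O x (x + 1) x1 (intf _) (ltNyr _) (cf x).
  by rewrite -Ff derive1E; exact/derivableP.
move=> xl; rewrite /F (@eq_Rintegral _ _ _ _ _ (cst 0)).
  by rewrite /Rintegral integral0.
by move=> y; rewrite inE/= in_itv/= => yx; rewrite f0// (le_trans yx).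
Qed.

End integration.

(** * The mollified Green function *)

Section kernel.
Context {R : realType}.
Implicit Types (f F : R -> R) (x : R).

Lemma nonneg_derive_le F f : (forall x, is_derive x 1 F (f x)) ->
  (forall x, 0 <= f x) -> forall x y : R, x <= y -> F x <= F y.
Proof.
move=> Ff f0 x y xy; have cF := is_derive_continuous Ff.
apply: (@ger0_derive1_ndecr _ F x y) => //.
- by move=> z _; rewrite derive1E (@derive_val _ _ _ _ _ _ _ (Ff z)).
- exact: continuous_subspaceT.
Qed.

(** [E] is the running exponential moment of the bump and [M] the total one. They serve both in the
    variation of constants formula for the fundamental solution and in evaluating the integrals of
    exponentials against bumps. *)
Lemma moment_ex (eta n : R) : 0 < eta -> exists E M,
  [/\ forall x, is_derive x 1 E (expR (n * x) * bump eta x),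
      forall x, x <= - eta -> E x = 0,
      forall x, eta <= x -> E x = M, 0 < M & forall x, 0 <= E x <= M].
Proof.
move=> eta0; pose f x := expR (n * x) * bump eta x.
have sf : smooth f by apply: smoothM; [exact: smooth_expRM|exact: smooth_bump].
have f0 x : ~~ (- eta < x < eta) -> f x = 0 by move=> /bump_eq0; rewrite /f => ->; rewrite mulr0.
have fge0 x : 0 <= f x by rewrite mulr_ge0 ?expR_ge0 ?bump_ge0.
have [|E Ef E0] := @antiderivative_ex _ f (- eta) (smooth_continuous sf).
  by move=> x xe; rewrite f0// negb_and -leNgt xe.
have Emono := nonneg_derive_le Ef fge0.
have Eright x : eta <= x -> E x = E eta.
  move=> ex; apply/eqP; rewrite -subr_eq0.
  rewrite -(@Rintegral_FTC _ E f)//; last exact: smooth_continuous.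
  rewrite (@eq_Rintegral _ _ _ _ _ (cst 0)); first by rewrite /Rintegral integral0.
  by move=> y; rewrite inE/= in_itv/= => /andP[ey _]; rewrite f0// negb_and -!leNgt ey orbT.
exists E, (E eta); split => //.
- rewrite -(E0 (- eta))//.
  apply: (@gtr0_derive1_lt_cc _ E (- eta) eta) => //.
  + move=> z; rewrite in_itv/= => ze.
    by rewrite derive1E (@derive_val _ _ _ _ _ _ _ (Ef z)) mulr_gt0 ?expR_gt0 ?bump_gt0.
  + exact: continuous_subspaceT (is_derive_continuous Ef).
  + by rewrite in_itv/= lexx/=; lra.
  + by rewrite in_itv/= lexx andbT; lra.
  + by lra.
- move=> x; apply/andP; split.
    have [/E0->//|xe] := leP x (- eta).
    by rewrite -(E0 (- eta))// Emono// ltW.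
  have [/Eright->//|xe] := leP eta x.
  by rewrite Emono// ltW.
Qed.

(** At a negative minimum the first derivative vanishes and c * phi is positive, so the second
    derivative is negative there, and by continuity just to the right; then [phi] decreases beyond
    its minimum. The inequality is asked only where [phi] is negative, the only place where
    [stencil_ex] controls the sign. *)
Lemma minimum_principle (phi phi1 phi2 : R -> R) (k c a b : R) :
  (forall x, is_derive x 1 phi (phi1 x)) ->
  (forall x, is_derive x 1 phi1 (phi2 x)) -> continuous phi2 ->
  (forall x, ~~ (a <= x <= b) -> phi x = 0) -> c < 0 ->
  (forall x, phi x < 0 -> phi2 x + k * phi1 x + c * phi x <= 0) ->
  forall x, 0 <= phi x.
Proof.
move=> d1 d2 c2 phi0 c0 H x; rewrite leNgt; apply/negP => phix.
have /andP[ax xb] : a <= x <= b.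
  by apply: contraTT phix => /phi0->; rewrite ltxx.
have cphi := is_derive_continuous d1.
(* The unit margins make the minimum point interior and leave room for a step to its right. *)
have [|z zab zmin] := @EVT_min _ phi (a - 1) (b + 1) _ (continuous_subspaceT cphi).
  by lra.
have phiz : phi z < 0.
  by rewrite (le_lt_trans _ phix)// zmin// in_itv/=; lra.
have /andP[az zb] : a <= z <= b.
  by apply: contraTT phiz => /phi0->; rewrite ltxx.
have phi1z : phi1 z = 0.
  have /is_derive_unique : is_derive z 1 phi 0.
    apply: (@derive1_at_min _ _ (a - 1) (b + 1)) => //.
    - by lra.
    - by rewrite in_itv/=; lra.
    - by move=> t tab; rewrite zmin//; apply: subset_itv_oo_cc.
  by move=> /(_ _ (d1 z)).
have phi2z : phi2 z < 0.
  have := H z phiz; rewrite phi1z mulr0 addr0.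
  have : 0 < c * phi z by rewrite nmulr_rgt0.
  by lra.
have : \forall y \near z, phi2 y < 0.
  by have := c2 z => /cvgr_lt; exact.
move=> /nbhs_ballP[e /= e0 He].
(* e / 2 stays in the ball where [phi2] is negative; 1 / 2 stays inside the enlarged interval. *)
pose d := Num.min (e / 2) (1 / 2).
have d0 : 0 < d by rewrite lt_min; lra.
have dle : d <= e / 2 /\ d <= 1 / 2 by split; rewrite ge_min lexx ?orbT.
have phi2neg y : z < y < z + d -> phi2 y < 0.
  move=> /andP[zy yz]; apply: He; rewrite /ball/= ltr_norml; lra.
have phi1neg y : z < y < z + d -> phi1 y < 0.
  move=> /andP[zy yz]; rewrite -phi1z.
  apply: (@ltr0_derive1_lt_cc _ phi1 z y) => //.
  - move=> t; rewrite in_itv/= => /andP[zt ty].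
    rewrite derive1E (@derive_val _ _ _ _ _ _ _ (d2 t)); apply: phi2neg; lra.
  - exact: continuous_subspaceT (is_derive_continuous d2).
  - by rewrite in_itv/= lexx ltW.
  - by rewrite in_itv/= lexx ltW.
have : phi (z + d) < phi z.
  apply: (@ltr0_derive1_lt_cc _ phi z (z + d)) => //.
  - move=> t; rewrite in_itv/= => ztd.
    by rewrite derive1E (@derive_val _ _ _ _ _ _ _ (d1 t)); apply: phi1neg.
  - exact: continuous_subspaceT.
  - by rewrite in_itv/=; lra.
  - by rewrite in_itv/=; lra.
  - by lra.
by rewrite ltNge zmin// in_itv/=; lra.
Qed.

End kernel.

(** * Fundamental solution and three-point stencil *)

Section stencil.
Context {R : realType}.
Implicit Types (x : R).

(* Psi is the mollified fundamental solution vanishing on the left; subtracting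
   the exponentials gives the one vanishing on the right. *)
Lemma fundamental_ex (n1 n2 eta : R) : n1 < n2 -> 0 < eta ->
  exists Psi Psi1 Psi2 : R -> R, exists k1 k2 : R,
  [/\ smooth Psi,
      (forall x, is_derive x 1 Psi (Psi1 x)) /\
        (forall x, is_derive x 1 Psi1 (Psi2 x)),
      (forall x, Psi2 x + (n1 + n2) * Psi1 x + n1 * n2 * Psi x = bump eta x),
      (forall x, 0 <= Psi x) /\ (forall x, x <= - eta -> Psi x = 0) &
      (forall x, 0 <= Psi x - (k1 * expR (- n1 * x) - k2 * expR (- n2 * x))) /\
      (forall x, eta <= x -> Psi x = k1 * expR (- n1 * x) - k2 * expR (- n2 * x))].
Proof.
move=> n12 eta0.
have [E1 [M1 [dE1 E1l E1r M1p E1b]]] := moment_ex n1 eta0.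
have [E2 [M2 [dE2 E2l E2r M2p E2b]]] := moment_ex n2 eta0.
have n21 : 0 < n2 - n1 by rewrite subr_gt0.
pose kap := (n2 - n1)^-1.
have kap0 : 0 < kap by rewrite invr_gt0.
pose e1 x := expR (- n1 * x); pose e2 x := expR (- n2 * x).
have de1 x : is_derive x 1 e1 (- n1 * e1 x) by exact: is_derive_expRM.
have de2 x : is_derive x 1 e2 (- n2 * e2 x) by exact: is_derive_expRM.
have ee1 x : e1 x * expR (n1 * x) = 1 by rewrite /e1 mulNr mulrC expRxMexpNx_1.
have ee2 x : e2 x * expR (n2 * x) = 1 by rewrite /e2 mulNr mulrC expRxMexpNx_1.
pose q x := expR ((n1 - n2) * x).
have dq x : is_derive x 1 q ((n1 - n2) * q x) by exact: is_derive_expRM.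
have qe x : e1 x * q x = e2 x by rewrite -expRD; congr expR; ring.
have qE x : q x * expR (n2 * x) = expR (n1 * x) by rewrite -expRD; congr expR; ring.
(* Variation of constants for (D + n1)(D + n2): the convolution of the bump with the kernel (e^(-n1
   x) - e^(-n2 x)) / (n2 - n1) supported on x > 0. *)
pose Psi x := kap * (e1 x * E1 x - e2 x * E2 x).
pose Psi1 x := kap * (- n1 * (e1 x * E1 x) + n2 * (e2 x * E2 x)).
pose Psi2 x := kap * (n1 ^+ 2 * (e1 x * E1 x) - n2 ^+ 2 * (e2 x * E2 x)) + bump eta x.
have sE n E : (forall x, is_derive x 1 E (expR (n * x) * bump eta x)) -> smooth E.
  move=> dE; apply: smooth_antiderivative dE _.
  by apply: smoothM; [exact: smooth_expRM|exact: smooth_bump].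
have de1E x : is_derive x 1 (fun y => e1 y * E1 y) (- n1 * (e1 x * E1 x) + bump eta x).
  apply: (is_derive_eq (is_derive_mul (de1 x) (dE1 x))).
  by rewrite [e1 x * (_ * _)]mulrA ee1 mul1r mulrA.
have de2E x : is_derive x 1 (fun y => e2 y * E2 y) (- n2 * (e2 x * E2 x) + bump eta x).
  apply: (is_derive_eq (is_derive_mul (de2 x) (dE2 x))).
  by rewrite [e2 x * (_ * _)]mulrA ee2 mul1r mulrA.
(* The two derivatives of these comparison functions have a sign because the
   density terms cancel. *)
have dT x : is_derive x 1 (fun y => E1 y - q y * E2 y) ((n2 - n1) * (q x * E2 x)).
  apply: (is_derive_eq (is_derive_sub (dE1 x) (is_derive_mul (dq x) (dE2 x)))).
  by rewrite [q x * (_ * _)]mulrA qE; ring.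
have T0 x : 0 <= E1 x - q x * E2 x.
  have [xe|xe] := leP x (- eta); first by rewrite E1l// E2l// mulr0 subrr.
  rewrite (le_trans _ (nonneg_derive_le dT _ (ltW xe)))//.
    by rewrite E1l// E2l// mulr0 subrr.
  by move=> y; have /andP[? _] := E2b y; rewrite !mulr_ge0 ?expR_ge0// ltW.
have dT' x : is_derive x 1 (fun y => (E2 y - M2) * q y - (E1 y - M1))
    ((n2 - n1) * (q x * (M2 - E2 x))).
  have dE2' : is_derive x 1 (fun y => E2 y - M2) (expR (n2 * x) * bump eta x - 0).
    exact: is_derive_sub (dE2 x) (is_derive_cst _ _ _).
  have dE1' : is_derive x 1 (fun y => E1 y - M1) (expR (n1 * x) * bump eta x - 0).
    exact: is_derive_sub (dE1 x) (is_derive_cst _ _ _).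
  apply: (is_derive_eq (is_derive_sub (is_derive_mul dE2' (dq x)) dE1')).
  by rewrite -qE; ring.
have T0' x : (E2 x - M2) * q x - (E1 x - M1) <= 0.
  have [xe|xe] := leP eta x; first by rewrite E1r// E2r// !subrr mul0r subrr.
  rewrite (le_trans (nonneg_derive_le dT' _ (ltW xe)))//.
    by move=> y; have /andP[_ ?] := E2b y; rewrite !mulr_ge0 ?expR_ge0// ?subr_ge0// ltW.
  by rewrite E1r// E2r// !subrr mul0r subrr.
exists Psi, Psi1, Psi2, (kap * M1), (kap * M2); split.
- apply: smoothZ; apply: smoothB; apply: smoothM.
  + exact: smooth_expRM.
  + exact: sE dE1.
  + exact: smooth_expRM.
  + exact: sE dE2.
- split=> x.
    apply: (is_derive_eq (is_derive_scale kap (is_derive_sub (de1E x) (de2E x)))).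
    by rewrite /Psi1; ring.
  apply: (is_derive_eq (is_derive_scale kap (is_derive_add
    (is_derive_scale (- n1) (de1E x)) (is_derive_scale n2 (de2E x))))).
  by rewrite /Psi2 /kap; field; exact: lt0r_neq0.
- by move=> x; rewrite /Psi2 /Psi1 /Psi; ring.
- split=> x; rewrite /Psi; last by move=> xe; rewrite E1l// E2l// !mulr0 subrr mulr0.
  by rewrite -qe -mulrA -mulrBr !mulr_ge0 ?expR_ge0 ?T0 ?ltW.
- split=> x; last by move=> xe; rewrite /Psi E1r// E2r// -/(e1 x) -/(e2 x); ring.
  rewrite (_ : _ - _ = kap * (e1 x * - ((E2 x - M2) * q x - (E1 x - M1)))).
    by rewrite !mulr_ge0 ?expR_ge0 ?oppr_ge0 ?T0' ?ltW.
  by rewrite /Psi -/(e1 x) -/(e2 x) -qe; ring.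
Qed.

(* The weights for which the values at x0 - d and x0 + d of any combination of
   e^(n1 x) and e^(n2 x) average to its value at x0. *)
Definition weightl (n1 n2 d : R) := (expR (- n1 * d) + expR (- n2 * d))^-1.
Definition weightr (n1 n2 d : R) :=
  expR (- n1 * d) * expR (- n2 * d) * (expR (- n1 * d) + expR (- n2 * d))^-1.

Lemma weight_sum_gt0 (n1 n2 d : R) : 0 < expR (- n1 * d) + expR (- n2 * d).
Proof. by rewrite addr_gt0 ?expR_gt0. Qed.

Lemma weightl_gt0 n1 n2 d : 0 < weightl n1 n2 d.
Proof. by rewrite invr_gt0 weight_sum_gt0. Qed.

Lemma weightr_gt0 n1 n2 d : 0 < weightr n1 n2 d.
Proof. by rewrite !mulr_gt0 ?expR_gt0// invr_gt0 weight_sum_gt0. Qed.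

(** Up to a positive factor the left side is a quadratic in e^(-t d) with roots at t = n1 and t =
    n2. It vanishes there, and for d > 0 it is negative for t strictly between them, which gives the
    strictness used in [comparison]. *)
Lemma weight_charE n1 n2 d t :
  weightl n1 n2 d * expR (- t * d) - 1 + weightr n1 n2 d * expR (t * d) =
  weightl n1 n2 d * expR (t * d) *
    ((expR (- t * d) - expR (- n1 * d)) * (expR (- t * d) - expR (- n2 * d))).
Proof.
have -> : expR (t * d) = (expR (- t * d))^-1 by rewrite -expRN; congr expR; ring.
have := weight_sum_gt0 n1 n2 d; rewrite /weightl /weightr.
set p1 := expR (- n1 * d); set p2 := expR (- n2 * d); set p := expR (- t * d).
have p0 : 0 < p by rewrite expR_gt0.
by move=> s0; field; rewrite ?lt0r_neq0.
Qed.

Definition stencil (n1 n2 eta d x0 x : R) :=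
  weightl n1 n2 d * bump eta (x - (x0 - d)) - bump eta (x - x0) +
  weightr n1 n2 d * bump eta (x - (x0 + d)).

(** The kernel is the weighted combination of three translates of the fundamental solution. The
    condition on [eta] separates the bumps, so that under the central one the right-hand side is
    nonpositive. *)
Lemma stencil_ex (n1 n2 eta d x0 : R) : n1 < 0 -> 0 < n2 -> 0 < eta ->
  2 * eta <= d -> exists phi phi1 phi2 : R -> R,
  [/\ smooth phi,
      (forall x, is_derive x 1 phi (phi1 x)) /\
        (forall x, is_derive x 1 phi1 (phi2 x)),
      (forall x, phi2 x + (n1 + n2) * phi1 x + n1 * n2 * phi x =
         stencil n1 n2 eta d x0 x),
      forall x, 0 <= phi x &
      forall x, ~~ (x0 - d - eta <= x <= x0 + d + eta) -> phi x = 0].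
Proof.
move=> n10 n20 eta0 etad; have n12 : n1 < n2 by exact: lt_trans n20.
have [P [P1 [P2 [k1 [k2 [sP [dP dP1] Peq [P0 Pl] [Q0 Pr]]]]]]] :=
  fundamental_ex n12 eta0.
pose B := weightl n1 n2 d; pose C := weightr n1 n2 d.
have B0 : 0 < B := weightl_gt0 _ _ _.
have C0 : 0 < C := weightr_gt0 _ _ _.
pose comb (f : R -> R) x := B * f (x - (x0 - d)) - f (x - x0) + C * f (x - (x0 + d)).
have dcomb f df : (forall x, is_derive x 1 f (df x)) ->
    forall x, is_derive x 1 (comb f) (comb df x).
  move=> fdf x; apply: is_derive_add.
    apply: is_derive_sub; last exact: is_derive_translate.
    by apply: is_derive_scale; exact: is_derive_translate.
  by apply: is_derive_scale; exact: is_derive_translate.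
have combE n x : B * expR (- n * (x - (x0 - d))) - expR (- n * (x - x0)) +
    C * expR (- n * (x - (x0 + d))) =
    (B * expR (- n * d) - 1 + C * expR (n * d)) * expR (- n * (x - x0)).
  rewrite (_ : - n * (x - (x0 - d)) = - n * d + - n * (x - x0)); last by ring.
  rewrite (_ : - n * (x - (x0 + d)) = n * d + - n * (x - x0)); last by ring.
  by rewrite !expRD; ring.
have comb1 x : B * expR (- n1 * (x - (x0 - d))) - expR (- n1 * (x - x0)) +
    C * expR (- n1 * (x - (x0 + d))) = 0.
  by rewrite combE weight_charE subrr !(mul0r, mulr0).
have comb2 x : B * expR (- n2 * (x - (x0 - d))) - expR (- n2 * (x - x0)) +
    C * expR (- n2 * (x - (x0 + d))) = 0.
  by rewrite combE weight_charE subrr !(mul0r, mulr0).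
have combl x : x <= x0 - eta -> comb P x = B * P (x - (x0 - d)).
  by move=> xe; rewrite /comb (Pl (x - x0)) ?(Pl (x - (x0 + d))); [ring|lra|lra].
(* [Q] vanishes on the right, as [P] does on the left. The weights annihilate both exponentials, so
   [P] and [Q] have the same combination, which is therefore compactly supported. *)
pose Q x := P x - (k1 * expR (- n1 * x) - k2 * expR (- n2 * x)).
have combQ x : comb P x = comb Q x.
  apply/eqP; rewrite -subr_eq0; apply/eqP; rewrite /comb /Q.
  transitivity (k1 * (B * expR (- n1 * (x - (x0 - d))) - expR (- n1 * (x - x0)) +
      C * expR (- n1 * (x - (x0 + d)))) -
    k2 * (B * expR (- n2 * (x - (x0 - d))) - expR (- n2 * (x - x0)) +
      C * expR (- n2 * (x - (x0 + d))))); first by ring.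
  by rewrite comb1 comb2 !mulr0 subrr.
have Qr x : eta <= x -> Q x = 0 by move=> xe; rewrite /Q Pr// subrr.
have combr x : x0 + eta <= x -> comb P x = C * Q (x - (x0 + d)).
  by move=> xe; rewrite combQ /comb (Qr (x - x0)) ?(Qr (x - (x0 - d))); [ring|lra|lra].
have comb0 x : ~~ (x0 - d - eta <= x <= x0 + d + eta) -> comb P x = 0.
  rewrite negb_and -!ltNge => /orP[xl|xr].
    by rewrite combl ?Pl ?mulr0//; lra.
  by rewrite combr ?Qr ?mulr0//; lra.
have combeq x : comb P2 x + (n1 + n2) * comb P1 x + n1 * n2 * comb P x =
    stencil n1 n2 eta d x0 x.
  by rewrite /stencil -!Peq /comb /B /C; ring.
have sc : smooth (comb P).
  apply: smoothD; first apply: smoothB.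
  - by apply: smoothZ; exact: smooth_translate.
  - exact: smooth_translate.
  - by apply: smoothZ; exact: smooth_translate.
exists (comb P), (comb P1), (comb P2); split => //.
  by split; exact: dcomb.
(* On either side of the central bump the combination is a positive multiple of a single translate
   of [P] or [Q], hence nonnegative; a negative value can occur only under that bump. *)
apply: (minimum_principle (k := n1 + n2) (c := n1 * n2) (dcomb _ _ dP) (dcomb _ _ dP1) _ comb0).
- apply: smooth_continuous; apply: smooth_is_derive (dcomb _ _ dP1).
  by apply: smooth_is_derive (dcomb _ _ dP).
- by rewrite nmulr_rlt0.
- move=> x cx; rewrite combeq /stencil.
  have xl : x0 - eta < x.
    by rewrite ltNge; apply/negP => /combl E; move: cx; rewrite E ltNge mulr_ge0// ltW.
  have xr : x < x0 + eta.
    by rewrite ltNge; apply/negP => /combr E; move: cx; rewrite E ltNge mulr_ge0 ?Q0// ltW.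
  rewrite (bump_eq0 (x := x - (x0 - d))); last by rewrite negb_and -!leNgt; apply/orP; right; lra.
  rewrite (bump_eq0 (x := x - (x0 + d))); last by rewrite negb_and -!leNgt; apply/orP; left; lra.
  by rewrite !mulr0 addr0 sub0r oppr_le0 bump_ge0.
Qed.

End stencil.

(** * Uniqueness *)

Section test_functions.
Context {R : realType}.
Notation mu := (@lebesgue_measure R).
Implicit Types (Omega K : set R) (phi u : R -> R).

Lemma test_function_smooth Omega phi : test_function Omega phi -> smooth phi.
Proof. by move=> [dphi _]; exact/smoothP. Qed.

Lemma smooth_test_function (a b c : R) phi : smooth phi -> b < c ->
  (forall x, ~~ (a <= x <= b) -> phi x = 0) -> test_function `]-oo, c[ phi.
Proof.
move=> /smoothP dphi bc phi0; split => //.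
exists `[a, b]%classic; split; first exact: segment_compact.
- by move=> x /=; rewrite !in_itv/= => /andP[_ /le_lt_trans]; exact.
- by move=> x /=; rewrite in_itv/= => /negP; exact: phi0.
Qed.

Lemma test_function_derive1 Omega phi :
  test_function Omega phi -> test_function Omega (derive1 phi).
Proof.
move=> [dphi [K [cK KO phi0]]]; split; first by move=> n x; rewrite -derive1Sn.
exists K; split => // x Kx.
have oK : open (~` K) by apply: closed_openC; apply: compact_closed.
rewrite derive1E; apply: derive_val.
apply: (@near_eq_is_derive _ R R (cst 0)).
by near=> y; rewrite phi0//; near: y; exact: open_nbhs_nbhs.
Unshelve. all: by end_near. Qed.

Lemma continuous_compact_bounded (f : R -> R) (K : set R) : continuous f -> compact K ->
  exists2 N : R, 0 <= N & forall x, K x -> `|f x| <= N.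
Proof.
move=> cf cK.
have : compact (f @` K).
  by apply: continuous_compact => //; exact: continuous_subspaceT.
move=> /compact_bounded [N [_ HN]].
exists (Num.max 0 N + 1); first by rewrite addr_ge0// le_max lexx.
move=> x Kx; apply: HN; last by exists x.
by rewrite (@le_lt_trans _ _ (Num.max 0 N)) ?le_max ?lexx ?orbT// ltrDl.
Qed.

Lemma test_function_bounded Omega phi : test_function Omega phi ->
  exists2 M : R, 0 < M & forall x, `|phi x| <= M.
Proof.
move=> tphi; have := smooth_continuous (test_function_smooth tphi).
case: tphi => _ [K [cK _ phi0]] cphi.
have [N N0 HN] := continuous_compact_bounded cphi cK.
exists (N + 1) => [|x]; first by rewrite ltr_wpDl.
have [Kx|Kx] := pselect (K x); last by rewrite phi0// normr0 addr_ge0.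
by rewrite (le_trans (HN _ Kx))// lerDl.
Qed.

(** The bound |u| <= 1 + |u|^p on the support of [phi], together with the boundedness of [phi],
    replaces Hoelder's inequality. *)
Lemma Lp_loc_mul_integrable Omega (p : R) u phi : measurable Omega -> 1 < p ->
  Lp_loc Omega p u -> test_function Omega phi ->
  mu.-integrable Omega (EFin \o (fun x => u x * phi x)).
Proof.
move=> mO p1 Lu tphi.
have [M M0 phiM] := test_function_bounded tphi.
have cphi := smooth_continuous (test_function_smooth tphi).
have [_ [K [cK KO phi0]]] := tphi.
have LuK := Lu K cK KO.
have mf : measurable_fun setT (u \_ K) by move: (LuK) => /andP[]; rewrite inE.
have mK : measurable K by exact: compact_measurable.
have uphiE : (fun x => u x * phi x) = (u \_ K) \* phi.
  apply/funext => x /=; rewrite patchE; case: ifPn => //.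
  by rewrite notin_setE => /phi0->; rewrite !mulr0.
have i1 : mu.-integrable setT (EFin \o (fun x => `|(u \_ K) x| `^ p)).
  by apply: Lfun_integrable => //; exact: ltW.
have iK : mu.-integrable K (EFin \o (cst 1 : R -> R)).
  apply: continuous_compact_integrable => //.
  by apply: continuous_subspaceT => x; exact: cvg_cst.
have i2 : mu.-integrable setT ((EFin \o (cst 1 : R -> R)) \_ K).
  exact: (@integrable_mkcond _ _ _ mu K _ mK).1 iK.
apply: (@integrableS _ _ _ mu setT) => //.
have i3 := integrableZl measurableT M (integrableD measurableT i2 i1).
rewrite uphiE; apply: le_integrable i3 => //.
  apply/measurable_EFinP; apply: measurable_funM => //; exact: continuous_measurable_fun.
move=> x _ /=; rewrite !patchE; case: ifPn => xK /=; last first.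
  by rewrite mul0r normr0 lee_fin.
rewrite lee_fin normrM mulrC [leRHS]ger0_norm; last by rewrite mulr_ge0 ?addr_ge0 ?powR_ge0 ?ltW.
apply: ler_pM => //.
have [u1|u1] := leP `|u x| 1; first by rewrite ler_wpDr// powR_ge0.
by rewrite ler_wpDl// le1r_powR// ltW.
Qed.

End test_functions.

Section linear_combination.
Context {d} {T : measurableType d} {R : realType}.
Variables (mu : {measure set T -> \bar R}) (D : set T).
Hypothesis mD : d.-measurable D.
Implicit Types (f g h : T -> R).

Lemma integrable_scale f (k : R) : mu.-integrable D (EFin \o f) ->
  mu.-integrable D (EFin \o (fun x => k * f x)).
Proof.
by move=> fi; exact: (integrableZl mD k fi).
Qed.

Lemma integrable_add f g : mu.-integrable D (EFin \o f) ->
  mu.-integrable D (EFin \o g) -> mu.-integrable D (EFin \o (fun x => f x + g x)).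
Proof.
by move=> fi gi; exact: (integrableD mD fi gi).
Qed.

Lemma integrable_sub f g : mu.-integrable D (EFin \o f) ->
  mu.-integrable D (EFin \o g) -> mu.-integrable D (EFin \o (fun x => f x - g x)).
Proof. by move=> fi gi; exact: (integrableB mD fi gi). Qed.

Lemma integrable_lincomb3 f g h (a b c : R) :
  mu.-integrable D (EFin \o f) -> mu.-integrable D (EFin \o g) ->
  mu.-integrable D (EFin \o h) ->
  mu.-integrable D (EFin \o (fun x => a * f x + b * g x + c * h x)).
Proof.
by move=> fi gi hi; do !apply: integrable_add; exact: integrable_scale.
Qed.

Lemma Rintegral_lincomb3 f g h (a b c : R) :
  mu.-integrable D (EFin \o f) -> mu.-integrable D (EFin \o g) ->
  mu.-integrable D (EFin \o h) ->
  \int[mu]_(x in D) (a * f x + b * g x + c * h x) =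
  a * \int[mu]_(x in D) f x + b * \int[mu]_(x in D) g x + c * \int[mu]_(x in D) h x.
Proof.
move=> fi gi hi.
rewrite RintegralD//; [|apply: integrable_add; exact: integrable_scale|exact: integrable_scale].
rewrite RintegralD//; [|exact: integrable_scale|exact: integrable_scale].
by rewrite !RintegralZl.
Qed.

(** Almost everywhere [f] agrees with its absolute value, whose integral is nonnegative. *)
Lemma Rintegral_ae_ge0 f : mu.-integrable D (EFin \o f) ->
  (\forall x \ae mu, D x -> 0 <= f x) -> 0 <= \int[mu]_(x in D) f x.
Proof.
move=> /[dup] fi /measurable_int mf f0.
rewrite /Rintegral fine_ge0//.
rewrite (@ae_eq_integral _ _ _ mu D (abse \o (EFin \o f)))//.
- by apply: integral_ge0 => x _; exact: abse_ge0.
- exact: measurableT_comp.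
- apply: filterS f0 => x fx Dx /=.
  by rewrite ger0_norm// fx.
Qed.

End linear_combination.

(** * Transfer of the operator to the test function *)

Section weak_formulation.
Context {R : realType}.
Variables (sigma r q p : R).
Notation mu := (@lebesgue_measure R).
Let A := sigma ^+ 2 / 2.
Let m := r - q - sigma ^+ 2 / 2.

(** Only the odd derivative changes sign when moved to the test function, hence the coefficient - m
    in the adjoint. The two integrability claims are what linearity needs when solutions are
    subtracted. *)
Lemma weak_operator (Omega : set R) (u u1 u2 phi phi1 phi2 : R -> R) :
  measurable Omega -> 1 < p -> W2p_loc Omega p u u1 u2 ->
  test_function Omega phi ->
  (forall x : R, is_derive x 1 phi (phi1 x)) ->
  (forall x : R, is_derive x 1 phi1 (phi2 x)) ->
  [/\ mu.-integrable Omega (EFin \o (fun x => Lop sigma r q (u x) (u1 x) (u2 x) * phi x)),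
      mu.-integrable Omega (EFin \o (fun x => u x * (A * phi2 x - m * phi1 x - r * phi x))) &
      \int[mu]_(x in Omega) (Lop sigma r q (u x) (u1 x) (u2 x) * phi x) =
      \int[mu]_(x in Omega) (u x * (A * phi2 x - m * phi1 x - r * phi x))].
Proof.
move=> mO p1 [Lu Lu1 Lu2 wu1 wu2] tphi d1 d2.
have phi1E : phi1 = derive1 phi.
  by apply/funext => x; rewrite derive1E (@derive_val _ _ _ _ _ _ _ (d1 x)).
have phi2E : phi2 = derive1 phi1.
  by apply/funext => x; rewrite derive1E (@derive_val _ _ _ _ _ _ _ (d2 x)).
have t1 : test_function Omega phi1 by rewrite phi1E; exact: test_function_derive1.
have t2 : test_function Omega phi2 by rewrite phi2E; exact: test_function_derive1.
have i0 := Lp_loc_mul_integrable mO p1 Lu tphi.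
have i1 := Lp_loc_mul_integrable mO p1 Lu t1.
have i2 := Lp_loc_mul_integrable mO p1 Lu t2.
have j1 := Lp_loc_mul_integrable mO p1 Lu1 tphi.
have j2 := Lp_loc_mul_integrable mO p1 Lu2 tphi.
have E1 : (fun x => Lop sigma r q (u x) (u1 x) (u2 x) * phi x) =
    (fun x => A * (u2 x * phi x) + m * (u1 x * phi x) + (- r) * (u x * phi x)).
  by apply/funext => x; rewrite /Lop -/A -/m; ring.
have E2 : (fun x => u x * (A * phi2 x - m * phi1 x - r * phi x)) =
    (fun x => A * (u x * phi2 x) + (- m) * (u x * phi1 x) + (- r) * (u x * phi x)).
  by apply/funext => x; ring.
rewrite E1 E2; split.
- exact: integrable_lincomb3.
- exact: integrable_lincomb3.
- rewrite !Rintegral_lincomb3//.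
  have := wu1 _ tphi; have := wu2 _ tphi; rewrite /derive1n/= -phi1E -phi2E => -> ->.
  by rewrite sqrrN expr1n expr1; ring.
Qed.

End weak_formulation.

Section characteristic_roots.
Context {R : realType}.
Variables (sigma r q n1 n2 : R).
Hypotheses (n10 : n1 < 0) (n20 : 0 < n2).
Hypotheses (rn1 : char_poly2 sigma r q n1 = 0) (rn2 : char_poly2 sigma r q n2 = 0).

(** Vieta's relations: the difference of the two root equations contains the nonzero factor n1 - n2,
    and substituting the sum back yields [char_prod]. *)
Lemma char_sum : r - q - sigma ^+ 2 / 2 = - (sigma ^+ 2 / 2 * (n1 + n2)).
Proof.
have n12 : n1 - n2 != 0 by rewrite subr_eq0 lt_eqF// (lt_trans n10).
apply: (mulfI n12); apply/eqP; rewrite -subr_eq0 -[X in _ == X](subrr 0).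
by rewrite -{1}rn1 -rn2 /char_poly2; apply/eqP; field.
Qed.

Lemma char_prod : r = - (sigma ^+ 2 / 2 * (n1 * n2)).
Proof.
by have := rn1; rewrite /char_poly2 char_sum; lra.
Qed.

End characteristic_roots.

(** * Exponentials integrated against bumps *)

Section bump_integrals.
Context {R : realType}.
Variable c : R.
Notation mu := (@lebesgue_measure R).

Lemma bump_translate_support (eta x0 x : R) :
  ~~ (x0 - eta <= x <= x0 + eta) -> bump eta (x - x0) = 0.
Proof.
move=> xN; apply: bump_eq0; apply: contra xN => /andP[? ?]; lra.
Qed.

Lemma continuous_support_integrable (D : set R) (a b : R) (f : R -> R) :
  measurable D -> continuous f -> (forall x, ~~ (a <= x <= b) -> f x = 0) ->
  mu.-integrable D (EFin \o f).
Proof.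
move=> mD cf f0; apply: (@integrableS _ _ _ mu setT) => //.
have -> : EFin \o f = (EFin \o f) \_ `[a, b].
  apply/funext => x; rewrite patchE; case: ifPn => //.
  by rewrite notin_setE/= in_itv/= => /negP /f0 ->.
apply: (@integrable_mkcond _ _ _ mu `[a, b]%classic _ (measurable_itv _)).1.
apply: continuous_compact_integrable; first exact: segment_compact.
exact: continuous_subspaceT.
Qed.

Lemma exp_bump_integrable (n eta x0 : R) : x0 + eta < c ->
  mu.-integrable `]-oo, c[ (EFin \o (fun x => expR (n * x) * bump eta (x - x0))).
Proof.
move=> etac.
apply: (@continuous_support_integrable _ (x0 - eta) (x0 + eta)).
- exact: measurable_itv.
- apply: smooth_continuous; apply: smoothM; first exact: smooth_expRM.
  exact/smooth_translate/smooth_bump.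
- by move=> x xN; rewrite bump_translate_support ?mulr0.
Qed.

Lemma exp_bump_integral (n eta : R) : 0 < eta -> exists2 M : R, 0 < M &
  forall x0 : R, x0 + eta < c ->
  \int[mu]_(x in `]-oo, c[) (expR (n * x) * bump eta (x - x0)) = expR (n * x0) * M.
Proof.
move=> eta0; have [E [M [dE El Er M0 _]]] := moment_ex n eta0.
exists M => // x0 x0c; pose F x := expR (n * x0) * E (x - x0).
have dF (x : R) : is_derive x 1 F (expR (n * x) * bump eta (x - x0)).
  apply: (is_derive_eq (is_derive_scale _ (is_derive_translate x0 dE x))).
  by rewrite mulrA -expRD; congr (expR _ * _); ring.
rewrite (@Rintegral_support _ _ `[x0 - eta, x0 + eta]).
- rewrite (Rintegral_FTC dF).
  + by rewrite /F Er ?El ?mulr0 ?subr0//; lra.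
  + apply: smooth_continuous; apply: smoothM; first exact: smooth_expRM.
    exact/smooth_translate/smooth_bump.
  + by lra.
- by move=> x /=; rewrite !in_itv/= => /andP[_ xe]; exact: le_lt_trans x0c.
- move=> x _ /=; rewrite in_itv/= => /negP xN.
  by rewrite bump_translate_support ?mulr0.
Qed.

End bump_integrals.

(** * Comparison of two strong solutions *)

Section comparison.
Context {R : realType}.
Variables (sigma r q p K1 k1 K2 n1 n2 : R).
Hypotheses (sigma0 : 0 < sigma) (p1 : 1 < p) (n10 : n1 < 0) (n20 : 0 < n2).
Hypotheses (rn1 : char_poly2 sigma r q n1 = 0) (rn2 : char_poly2 sigma r q n2 = 0).
Notation mu := (@lebesgue_measure R).
Notation c := (ln k1).
Notation sol := (strong_solution sigma r q p K1 k1 K2).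

(* Where V > W the obstacle is inactive for V, so V - W is a subsolution there. *)
Lemma solution_gap_subsolution (V W : R -> R) (phi phi1 phi2 : R -> R) (a b : R) :
  sol V -> sol W -> b < c -> (forall x, a <= x <= b -> W x < V x) ->
  smooth phi -> (forall x : R, is_derive x 1 phi (phi1 x)) ->
  (forall x : R, is_derive x 1 phi1 (phi2 x)) ->
  (forall x, 0 <= phi x) -> (forall x, ~~ (a <= x <= b) -> phi x = 0) ->
  let m x := phi2 x + (n1 + n2) * phi1 x + n1 * n2 * phi x in
  mu.-integrable `]-oo, c[ (EFin \o (fun x => (V x - W x) * m x)) /\
  0 <= \int[mu]_(x in `]-oo, c[) ((V x - W x) * m x).
Proof.
move=> [_ _ _ _ [V1 [V2 [wV _ eV]]]] [_ _ _ psiW [W1 [W2 [wW geW _]]]].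
move=> bc VW sphi d1 d2 phi0 phis m.
have mO : measurable `]-oo, c[%classic by exact: measurable_itv.
have tphi := smooth_test_function sphi bc phis.
pose A := sigma ^+ 2 / 2.
have A0 : 0 < A by rewrite divr_gt0// exprn_gt0.
(* By Vieta the adjoint operator is A (D + n1)(D + n2), the one inverted by the stencil kernel. *)
have mE x : A * phi2 x - (r - q - sigma ^+ 2 / 2) * phi1 x - r * phi x = A * m x.
  by rewrite (char_sum n10 n20 rn1 rn2) [in r * _](char_prod n10 n20 rn1 rn2) /m -/A; ring.
have [iLV iV eqV] := weak_operator sigma r q mO p1 wV tphi d1 d2.
have [iLW iW eqW] := weak_operator sigma r q mO p1 wW tphi d1 d2.
rewrite (_ : (fun x => V x * _) = fun x => A * (V x * m x)) in iV; last first.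
  by apply/funext => x; rewrite mE; ring.
rewrite (_ : (fun x => W x * _) = fun x => A * (W x * m x)) in iW; last first.
  by apply/funext => x; rewrite mE; ring.
(* The third term, with coefficient 0, fits the difference to the three-term linearity lemmas. *)
have GE x : (V x - W x) * m x =
    A^-1 * (A * (V x * m x)) + - A^-1 * (A * (W x * m x)) + 0 * (A * (W x * m x)).
  by field; exact: lt0r_neq0.
have -> : (fun x => (V x - W x) * m x) = (fun x => A^-1 * (A * (V x * m x)) +
    - A^-1 * (A * (W x * m x)) + 0 * (A * (W x * m x))) by apply/funext.
split; first exact: integrable_lincomb3.
rewrite Rintegral_lincomb3// mul0r addr0.
have <- : \int[mu]_(x in `]-oo, c[) (Lop sigma r q (V x) (V1 x) (V2 x) * phi x) =
    \int[mu]_(x in `]-oo, c[) (A * (V x * m x)).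
  by rewrite eqV; apply: eq_Rintegral => x _; rewrite mE; ring.
have <- : \int[mu]_(x in `]-oo, c[) (Lop sigma r q (W x) (W1 x) (W2 x) * phi x) =
    \int[mu]_(x in `]-oo, c[) (A * (W x * m x)).
  by rewrite eqW; apply: eq_Rintegral => x _; rewrite mE; ring.
rewrite mulNr -mulrBr mulr_ge0 ?invr_ge0 ?(ltW A0)// -RintegralB//.
apply: Rintegral_ae_ge0 => //.
  exact: integrable_sub.
move: geW eV; apply: filterS2; first exact: (ae_filter_ringOfSetsType mu).
move=> x geWx eVx xc; rewrite -mulrBl.
have [xab|/phis->] := boolP (a <= x <= b); last by rewrite mulr0.
rewrite mulr_ge0//.
have xltc : x < c by move: xc; rewrite /= in_itv.
have WV := VW x xab.
have LW : 0 <= - Lop sigma r q (W x) (W1 x) (W2 x) by exact: geWx.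
have LV : - Lop sigma r q (V x) (V1 x) (V2 x) = 0.
  by apply: eVx => //; exact: le_lt_trans (psiW x (ltW xltc)) WV.
lra.
Qed.

Lemma comparison (V W : R -> R) : sol V -> sol W ->
  forall x, x <= c -> V x <= W x.
Proof.
move=> sV sW.
have [bV cV Vc _ _] := sV; have [bW cW Wc _ _] := sW.
move=> x0 x0c; rewrite leNgt; apply/negP => VW0.
pose w x := V x - W x.
have [M M0 wM] : exists2 M : R, 0 < M & forall x, x <= c -> w x <= M.
  move: bV bW => [N1 [_ HN1]] [N2 [_ HN2]].
  pose N := Num.max (Num.max N1 N2) 0 + 1.
  have NN1 : N1 < N by rewrite ltr_pwDr// !le_max lexx.
  have NN2 : N2 < N by rewrite ltr_pwDr// !le_max lexx orbT.
  have N0 : 0 < N by rewrite ltr_wpDl// le_max lexx orbT.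
  exists (N + N); first by rewrite addr_gt0.
  move=> x xc; have xI : `]-oo, c]%classic x by rewrite /= in_itv.
  have := HN1 _ NN1 x xI; have := HN2 _ NN2 x xI => /=.
  rewrite !ler_norml /w => /andP[? ?] /andP[? ?]; lra.
(* Being negative, [th] makes e^(-th x) decay at -oo, so the bounded gap times it attains its
   maximum; lying strictly between n1 and n2, it makes the mean value inequality strict. *)
pose th := n1 / 2.
have th0 : th < 0 by have := n10; rewrite /th; lra.
pose v x := w x * expR (- th * x).
have wv x : w x = v x * expR (th * x).
  by rewrite /v -mulrA -expRD mulNr addNr expR0 mulr1.
have cw : {within `]-oo, c], continuous w}.
  by move=> x; apply: continuousB; [exact: cV|exact: cW].
have cexp k : continuous (fun x : R => expR (k * x)).
  exact: smooth_continuous (smooth_expRM _).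
have cv : {within `]-oo, c], continuous v}.
  by move=> x; apply: continuousM; [exact: cw|exact: (continuous_subspaceT (cexp _))].
have v0 : 0 < v x0 by rewrite mulr_gt0 ?expR_gt0// subr_gt0.
have vc : v c = 0 by rewrite /v /w Vc Wc subrr mul0r.
have x0ltc : x0 < c.
  by rewrite lt_neqAle x0c andbT; apply: contraTneq v0 => ->; rewrite vc ltxx.
(* Left of the second entry, M e^(-th x) is at most v(x0) / 2, so no maximum lies there; the minimum
   with [x0] keeps [x0] in [A, ln k1]. *)
pose A := Num.min x0 (ln (v x0 / (2 * M)) / - th).
have Ax0 : A <= x0 by rewrite ge_min lexx.
have vA x : x <= A -> v x < v x0.
  move=> xA; have xc : x <= c by rewrite (le_trans xA)// (le_trans Ax0).
  have vM0 : 0 < v x0 / (2 * M) by rewrite divr_gt0// mulr_gt0.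
  have : expR (- th * x) <= v x0 / (2 * M).
    rewrite -[leRHS]lnK ?posrE// ler_expR mulrC -ler_pdivlMr ?oppr_gt0//.
    by rewrite (le_trans xA)// ge_min lexx orbT.
  move=> He; rewrite (@le_lt_trans _ _ (M * (v x0 / (2 * M))))//.
    rewrite (@le_trans _ _ (M * expR (- th * x)))//.
      by rewrite ler_wpM2r ?expR_ge0 ?wM.
    by rewrite ler_wpM2l// ltW.
  by rewrite (_ : _ * _ = v x0 / 2); [lra|field; exact: lt0r_neq0].
have [|xs xsA vmax] := @EVT_max _ v A c (le_trans Ax0 x0c).
  by apply: continuous_subspaceW cv => x /=; rewrite !in_itv/= => /andP[].
have vs : v x0 <= v xs by apply: vmax; rewrite in_itv/= Ax0.
have vs0 : 0 < v xs by exact: lt_le_trans vs.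
have Axs : A < xs.
  by rewrite ltNge; apply/negP => /vA; rewrite ltNge vs.
have xsc : xs < c.
  rewrite lt_neqAle; move: xsA; rewrite in_itv/= => /andP[_ ->]; rewrite andbT.
  by apply: contraTneq vs0 => ->; rewrite vc ltxx.
have cvs : {for xs, continuous v}.
  have : {within `]-oo, c[, continuous v}.
    by apply: continuous_subspaceW cv => x /=; rewrite !in_itv/=; exact: ltW.
  rewrite continuous_open_subspace; last exact: interval_open.
  by apply; rewrite inE/= in_itv.
have near_xs (t : R) : t < v xs ->
    exists2 e : R, 0 < e & forall y : R, `|y - xs| < e -> t < v y.
  move=> tv; have : \forall y \near xs, t < v y by have := cvs => /cvgr_gt; exact.
  move=> /nbhs_ballP[e /= e0 He]; exists e => // y ye.
  by apply: He; rewrite /ball/= distrC.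
have [e1 e10 He1] := near_xs 0 vs0.
(* Since [eta] will be at most d / 2, the kernel lives within 3 d / 2 of [xs]. The three entries
   keep this range where v is positive, to the right of A, and to the left of ln k1. *)
pose d := Num.min (e1 / 4) (Num.min ((xs - A) / 2) ((c - xs) / 4)).
have d0 : 0 < d by rewrite !lt_min !divr_gt0// subr_gt0.
have [de1 dA dc] : [/\ d <= e1 / 4, d <= (xs - A) / 2 & d <= (c - xs) / 4].
  by rewrite /d !ge_min !lexx !orbT.
pose B := weightl n1 n2 d; pose C := weightr n1 n2 d.
have B0 : 0 < B := weightl_gt0 _ _ _.
have C0 : 0 < C := weightr_gt0 _ _ _.
(* The defect of e^(th x) in the mean value equality, positive because th lies between the roots. *)
pose gap := - (B * expR (- th * d) - 1 + C * expR (th * d)).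
have gap0 : 0 < gap.
  rewrite oppr_gt0 weight_charE pmulr_rlt0 ?mulr_gt0 ?expR_gt0//.
  have pl : expR (- th * d) < expR (- n1 * d).
    by rewrite ltr_expR ltr_pM2r//; have := n10; rewrite /th; lra.
  have pr : expR (- n2 * d) < expR (- th * d).
    by rewrite ltr_expR ltr_pM2r//; have := n10; have := n20; rewrite /th; lra.
  by rewrite nmulr_rlt0 ?subr_gt0 ?subr_lt0.
(* Near [xs], mollification costs at most half of the gap in the central value; the other half gives
   the contradiction. *)
have [|e2 e20 He2] := near_xs ((1 - gap / 2) * v xs).
  by rewrite gtr_pMl//; lra.
pose eta := Num.min e2 (d / 2).
have eta0 : 0 < eta by rewrite lt_min e20 divr_gt0.
have [etae etad] : eta <= e2 /\ eta <= d / 2 by rewrite /eta !ge_min !lexx orbT.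
have [|phi [phi1 [phi2 [sphi [d1 d2] phieq phi0 phis]]]] :=
  @stencil_ex _ n1 n2 eta d xs n10 n20 eta0; first by lra.
have [||iw w0] := solution_gap_subsolution sV sW _ _ sphi d1 d2 phi0 phis.
- by lra.
- move=> x xx; have : 0 < v x by apply: He1; rewrite ltr_norml; lra.
  by rewrite /v pmulr_lgt0 ?expR_gt0// subr_gt0.
have [Mth Mth0 HM] := @exp_bump_integral _ (ln k1) th eta eta0.
pose I (z x : R) := expR (th * x) * bump eta (x - z).
have iI (z : R) : z + eta < c -> mu.-integrable `]-oo, c[ (EFin \o I z).
  exact: exp_bump_integrable.
have c1 : xs - d + eta < c by lra.
have c2 : xs + eta < c by lra.
have c3 : xs + d + eta < c by lra.
have mO : measurable `]-oo, c[%classic by exact: measurable_itv.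
(* Bounding v by its maximum under the side bumps and from below under the central one leaves v(xs)
   times a positive moment times B e^(-th d) + C e^(th d) - (1 - gap / 2) = - gap / 2. *)
move: w0; apply/negP; rewrite -ltNge.
apply: (@le_lt_trans _ _ (\int[mu]_(x in `]-oo, c[)
   (v xs * B * I (xs - d) x + - ((1 - gap / 2) * v xs) * I xs x + v xs * C * I (xs + d) x))).
  apply: le_Rintegral => //.
    by apply: integrable_lincomb3 => //; exact: iI.
  move=> x /=; rewrite in_itv/= => xc; rewrite phieq -/(w x) wv /stencil -/B -/C /I.
  have vle z : xs - d <= z -> v x * bump eta (x - z) <= v xs * bump eta (x - z).
    move=> zd; have [xz|xz] := boolP (- eta < x - z < eta); last by rewrite bump_eq0 ?mulr0.
    rewrite ler_wpM2r ?bump_ge0// vmax// in_itv/= (ltW xc) andbT; lra.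
  have vge : (1 - gap / 2) * v xs * bump eta (x - xs) <= v x * bump eta (x - xs).
    have [xz|xz] := boolP (- eta < x - xs < eta); last by rewrite bump_eq0 ?mulr0.
    rewrite ler_wpM2r ?bump_ge0// ltW// He2// ltr_norml; lra.
  have := vle (xs - d) (lexx _); have := vle (xs + d) _.
  rewrite (_ : xs - d <= xs + d); last by lra.
  move=> /(_ isT) H3 H1.
  rewrite -subr_ge0 (_ : _ - _ = expR (th * x) * (
    B * (v xs * bump eta (x - (xs - d)) - v x * bump eta (x - (xs - d))) +
    (v x * bump eta (x - xs) - (1 - gap / 2) * v xs * bump eta (x - xs)) +
    C * (v xs * bump eta (x - (xs + d)) - v x * bump eta (x - (xs + d))))); last by ring.
  have H2 := vge; rewrite -subr_ge0 in H1; rewrite -subr_ge0 in H2; rewrite -subr_ge0 in H3.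
  apply: mulr_ge0; first exact: expR_ge0.
  apply: addr_ge0; last exact: mulr_ge0 (ltW C0) H3.
  by apply: addr_ge0 => //; exact: mulr_ge0 (ltW B0) H1.
rewrite Rintegral_lincomb3 ?HM//; try exact: iI.
rewrite (_ : _ + _ = v xs * Mth * expR (th * xs) * (- (gap / 2))); last first.
  rewrite (_ : th * (xs - d) = th * xs + - th * d); last by ring.
  rewrite (_ : th * (xs + d) = th * xs + th * d); last by ring.
  by rewrite !expRD /gap; field.
rewrite mulrN oppr_lt0; apply: mulr_gt0; last exact: divr_gt0.
by apply: mulr_gt0; [exact: mulr_gt0|exact: expR_gt0].
Qed.

End comparison.

(** * Piecewise smooth functions *)

Section piecewise.
Context {R : realType}.
Notation mu := (@lebesgue_measure R).
Implicit Types (f g h k u : R -> R) (x : R).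

(** The tests, strict at [a] and weak at [b], are those of [V_uncapped], so that it is an instance
    by conversion. *)
Definition piecewise (a b : R) (u0 u1 u2 : R -> R) (x : R) : R :=
  if x < a then u0 x else if x <= b then u1 x else u2 x.

Lemma bounded_Lp_loc (Omega : set R) (p : R) u : 1 < p ->
  measurable_fun setT u ->
  (forall K, compact K -> exists2 N : R, 0 <= N & forall x, K x -> `|u x| <= N) ->
  Lp_loc Omega p u.
Proof.
move=> p1 mu_ ub K cK _; have [N N0 uN] := ub K cK.
have mK : measurable K by exact: compact_measurable.
have muK : measurable_fun setT (u \_ K).
  by apply/(measurable_restrictT _ mK); exact: measurable_funTS.
apply/andP; split; first by rewrite inE.
rewrite inE/= /finite_norm unlock /Lnorm; apply: poweR_lty.
have iK : mu.-integrable K (EFin \o (cst (N `^ p) : R -> R)).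
  apply: continuous_compact_integrable => //.
  by apply: continuous_subspaceT => x; exact: cvg_cst.
have i2 : mu.-integrable setT ((EFin \o (cst (N `^ p) : R -> R)) \_ K).
  exact: (@integrable_mkcond _ _ _ mu K _ mK).1 iK.
have : mu.-integrable setT (EFin \o (fun x => `|(u \_ K) x| `^ p)).
  apply: le_integrable i2 => //.
    apply/measurable_EFinP.
    apply: (@measurableT_comp _ _ _ _ _ _ (@powR R ^~ p)) => //.
    exact: measurableT_comp.
  move=> x _ /=; rewrite !patchE; case: ifPn => [/set_mem Kx|_]/=.
    by rewrite lee_fin !(ger0_norm (powR_ge0 _ _)) ge0_ler_powR ?nnegrE ?uN//
      ltW// (lt_trans ltr01).
  by rewrite normr0 powR0 ?normr0// gt_eqF// (lt_trans ltr01).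
move=> /integrableP[_]; rewrite (_ : (\int[mu]_x _ = \int[mu]_x (`|(EFin \o u \_ K) x| `^ p))%E)//.
by apply: eq_integral => x _ /=; rewrite ger0_norm ?powR_ge0.
Qed.

Lemma continuous_mul_add f g h k : continuous f -> continuous g ->
  continuous h -> continuous k -> continuous (fun x => f x * g x + h x * k x).
Proof.
by move=> cf cg ch ck x; apply: cvgD; apply: cvgM; [exact: cf|exact: cg|exact: ch|exact: ck].
Qed.

Lemma piecewise_Lp_loc (Omega : set R) (p a b : R) u0 u1 u2 : 1 < p ->
  continuous u0 -> continuous u1 -> continuous u2 ->
  Lp_loc Omega p (piecewise a b u0 u1 u2).
Proof.
move=> p1 c0 c1 c2; apply: bounded_Lp_loc => //.
  apply: measurable_fun_ifT; first exact: measurable_fun_ltr.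
    exact: continuous_measurable_fun.
  apply: measurable_fun_ifT; first exact: measurable_fun_ler.
    exact: continuous_measurable_fun.
  exact: continuous_measurable_fun.
move=> K cK.
have [N0 N00 u0N] := continuous_compact_bounded c0 cK.
have [N1 N10 u1N] := continuous_compact_bounded c1 cK.
have [N2 N20 u2N] := continuous_compact_bounded c2 cK.
exists (N0 + N1 + N2); first by rewrite !addr_ge0.
move=> x Kx; have := u0N x Kx; have := u1N x Kx; have := u2N x Kx.
by rewrite /piecewise; case: ifP => _; [|case: ifP => _]; lra.
Qed.

(** On each piece the sum of the two integrands is the derivative of u * phi. The boundary terms
    cancel at [a] and [b] by continuity and vanish at the outer ends because [phi] does. *)
Lemma piecewise_weak_derivative1 (a b c : R) u0 u1 u2 d0 d1 d2 :
  a <= b -> b <= c ->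
  (forall x, is_derive x 1 u0 (d0 x)) -> (forall x, is_derive x 1 u1 (d1 x)) ->
  (forall x, is_derive x 1 u2 (d2 x)) ->
  continuous d0 -> continuous d1 -> continuous d2 ->
  u0 a = u1 a -> (b < c -> u1 b = u2 b) ->
  forall phi, test_function `]-oo, c[ phi ->
  \int[mu]_(x in `]-oo, c[) (piecewise a b u0 u1 u2 x * derive1 phi x) =
  - \int[mu]_(x in `]-oo, c[) (piecewise a b d0 d1 d2 x * phi x).
Proof.
move=> ab bc du0 du1 du2 c0 c1 c2 ua ub phi tphi.
have sphi := test_function_smooth tphi.
have dphi := smooth_derive1 sphi.
have cdphi := smooth_continuous (smooth_derive1_smooth sphi).
have cphi := smooth_continuous sphi.
have [_ [K [cK KO phi0]]] := tphi.
have phic : phi c = 0.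
  by apply: phi0 => /KO; rewrite /= in_itv/= ltxx.
have [A Aa phiA] : exists2 A : R, A <= a & forall x, x <= A -> phi x = 0.
  have [N [_ HN]] := compact_bounded cK.
  exists (Num.min a (- (Num.max N 0 + 1)) - 1).
    by rewrite lerBlDr (@le_trans _ _ a) ?ge_min ?lexx// lerDl.
  move=> x xA; apply: phi0 => Kx.
  have := HN (Num.max N 0 + 1); rewrite ltr_pwDr ?le_max ?lexx// => /(_ isT x Kx).
  rewrite /= ler_norml => /andP[+ _]; apply/negP; rewrite -ltNge.
  rewrite (le_lt_trans xA)// ltrBlDr ltr_pwDr// ge_min lexx orbT//.
(* Regarded on the whole line, [phi] yields integrability on every piece, also on [A, c], whose
   endpoint c lies outside the original domain. *)
have tT : test_function setT phi.
  by split; [case: tphi|exists K; split].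
have tT' := test_function_derive1 tT.
pose f := fun x => piecewise a b u0 u1 u2 x * derive1 phi x.
pose g := fun x => piecewise a b d0 d1 d2 x * phi x.
(* Any exponent above 1 serves for the local integrability; 2 is taken. *)
have fi : mu.-integrable setT (EFin \o f).
  apply: (@Lp_loc_mul_integrable _ _ 2) => //; first lra.
  by apply: piecewise_Lp_loc; [lra|exact: is_derive_continuous du0
    |exact: is_derive_continuous du1|exact: is_derive_continuous du2].
have gi : mu.-integrable setT (EFin \o g).
  by apply: (@Lp_loc_mul_integrable _ _ 2) => //; [lra|apply: piecewise_Lp_loc; [lra|..]].
have fgi : mu.-integrable setT (EFin \o (fun x => f x + g x)).
  exact: integrable_add.
have iS (h : R -> R) (D : set R) : mu.-integrable setT (EFin \o h) -> measurable D ->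
    mu.-integrable D (EFin \o h).
  by move=> hi mD; exact: (@integrableS _ _ _ mu setT).
apply/eqP; rewrite -addr_eq0 -RintegralD//; [|exact: iS|exact: iS]; apply/eqP.
have Kc0 x : ~ `[A, c]%classic x -> phi x = 0.
  rewrite /= in_itv/= => /negP; rewrite negb_and -!ltNge => /orP[xA|cx].
    by rewrite phiA// ltW.
  by apply: phi0 => /KO; rewrite /= in_itv/= ltNge (ltW cx).
have Kc0' x : ~ `[A, c]%classic x -> derive1 phi x = 0.
  move=> xAc; have oC : open (~` `[A, c]%classic) by exact/closed_openC/interval_closed.
  rewrite derive1E; apply: derive_val; apply: (@near_eq_is_derive _ R R (cst 0)).
  by near=> y; rewrite Kc0//; near: y; exact: open_nbhs_nbhs.
have h0 x : ~ `[A, c]%classic x -> f x + g x = 0.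
  by move=> xAc; rewrite /f /g Kc0 ?Kc0' ?mulr0 ?addr0.
have h0' x : ~ `]-oo, c[%classic x -> f x + g x = 0.
  have [_ [K' [_ KO' phi'0]]] := test_function_derive1 tphi.
  by move=> xO; rewrite /f /g phi0 ?phi'0 ?mulr0 ?addr0// => [/KO'|/KO].
rewrite -(@Rintegral_support _ setT)//; last by move=> x _; exact: h0'.
rewrite (@Rintegral_support _ setT `[A, c])//; last by move=> x _; exact: h0.
have G u d : (forall x, is_derive x 1 u (d x)) -> continuous d -> forall s t, s <= t ->
    \int[mu]_(x in `[s, t]) (u x * derive1 phi x + d x * phi x) = u t * phi t - u s * phi s.
  move=> du cd s t st.
  have dF (x : R) : is_derive x 1 (fun x => u x * phi x) (u x * derive1 phi x + d x * phi x).
    by apply: (is_derive_eq (is_derive_mul (du x) (dphi x))); rewrite addrC.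
  apply: (Rintegral_FTC dF) => //.
  by apply: continuous_mul_add => //; exact: is_derive_continuous du.
have ci u d (D : set R) : measurable D -> (forall x, is_derive x 1 u (d x)) -> continuous d ->
    mu.-integrable D (EFin \o (fun x => u x * derive1 phi x + d x * phi x)).
  move=> mD du cd; apply: (@continuous_support_integrable _ _ A c) => //.
    by apply: continuous_mul_add => //; exact: is_derive_continuous du.
  by move=> x /negP xAc; rewrite Kc0 ?Kc0' ?mulr0 ?addr0//= in_itv.
have mI (i : interval R) : measurable ([set` i] : set R) by exact: measurable_itv.
have hA : \int[mu]_(x in `[A, a]) (f x + g x) = u0 a * phi a.
  (* At [a] itself [piecewise] already uses the middle branch, so this null endpoint is dropped to
     identify the integrand and then restored. *)
  rewrite -Rintegral_itv_bndo_bndc; last exact: (iS _ _ fgi (mI _)).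
  transitivity (\int[mu]_(x in `[A, a[) (u0 x * derive1 phi x + d0 x * phi x)).
    apply: eq_Rintegral => x; rewrite inE/= in_itv/= => /andP[_ xa].
    by rewrite /f /g /piecewise xa.
  rewrite Rintegral_itv_bndo_bndc; last exact: (ci _ _ _ (mI _) du0 c0).
  by rewrite (G _ _ du0 c0)// [phi A]phiA// mulr0 subr0.
have hB : \int[mu]_(x in `]a, b]) (f x + g x) = u1 b * phi b - u1 a * phi a.
  transitivity (\int[mu]_(x in `]a, b]) (u1 x * derive1 phi x + d1 x * phi x)).
    apply: eq_Rintegral => x; rewrite inE/= in_itv/= => /andP[ax xb].
    by rewrite /f /g /piecewise ltNge (ltW ax) /= xb.
  rewrite Rintegral_itv_obnd_cbnd; last exact: (ci _ _ _ (mI _) du1 c1).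
  exact: G.
have hC : \int[mu]_(x in `]b, c]) (f x + g x) = - (u1 b * phi b).
  transitivity (\int[mu]_(x in `]b, c]) (u2 x * derive1 phi x + d2 x * phi x)).
    apply: eq_Rintegral => x; rewrite inE/= in_itv/= => /andP[bx xc].
    by rewrite /f /g /piecewise !ltNge (ltW (le_lt_trans ab bx)) /= leNgt bx.
  rewrite Rintegral_itv_obnd_cbnd; last exact: (ci _ _ _ (mI _) du2 c2).
  rewrite (G _ _ du2 c2)// phic mulr0 sub0r; congr (- _).
  (* If b = c the two branches may disagree at b, but phi vanishes there. *)
  move: bc; rewrite le_eqVlt => /predU1P[->|bc]; first by rewrite phic !mulr0.
  by rewrite ub.
have splitA := @Rintegral_itvB _ (fun x => f x + g x) (BLeft A) (BRight c) a
  (iS _ _ fgi (mI _)).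
have splitB := @Rintegral_itvB _ (fun x => f x + g x) (BRight a) (BRight c) b
  (iS _ _ fgi (mI _)).
rewrite !bnd_simp in splitA splitB.
move: (splitA Aa (le_trans ab bc)) (splitB ab bc); rewrite hA hB hC ua.
by move=> <-; lra.
Unshelve. all: by end_near. Qed.

(** Values and slopes fit at the junctions while second derivatives may jump. The first-order
    formula is applied to the function with test function phi', then to its derivative with phi. *)
Lemma piecewise_W2p (a b c p : R) u0 u1 u2 d0 d1 d2 e0 e1 e2 : 1 < p ->
  a <= b -> b <= c ->
  (forall x, is_derive x 1 u0 (d0 x)) -> (forall x, is_derive x 1 u1 (d1 x)) ->
  (forall x, is_derive x 1 u2 (d2 x)) ->
  (forall x, is_derive x 1 d0 (e0 x)) -> (forall x, is_derive x 1 d1 (e1 x)) ->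
  (forall x, is_derive x 1 d2 (e2 x)) ->
  continuous e0 -> continuous e1 -> continuous e2 ->
  u0 a = u1 a -> (b < c -> u1 b = u2 b) ->
  d0 a = d1 a -> (b < c -> d1 b = d2 b) ->
  W2p_loc `]-oo, c[ p (piecewise a b u0 u1 u2) (piecewise a b d0 d1 d2)
    (piecewise a b e0 e1 e2).
Proof.
move=> p1 ab bc du0 du1 du2 dd0 dd1 dd2 c0 c1 c2 ua ub da db.
have cd0 := is_derive_continuous dd0; have cd1 := is_derive_continuous dd1.
have cd2 := is_derive_continuous dd2.
have cu0 := is_derive_continuous du0; have cu1 := is_derive_continuous du1.
have cu2 := is_derive_continuous du2.
split.
- exact: piecewise_Lp_loc.
- exact: piecewise_Lp_loc.
- exact: piecewise_Lp_loc.
- by move=> phi tphi; rewrite expr1 mulN1r; exact: piecewise_weak_derivative1.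
- move=> phi tphi; rewrite sqrrN expr1n mul1r [derive1n 2 phi]/(derive1 (derive1 phi)).
  rewrite (piecewise_weak_derivative1 ab bc du0 du1 du2 cd0 cd1 cd2 ua ub
    (test_function_derive1 tphi)).
  by rewrite (piecewise_weak_derivative1 ab bc dd0 dd1 dd2 c0 c1 c2 da db tphi) opprK.
Qed.


End piecewise.

(** * The candidate solution *)

Section profile.
Context {R : realType}.
Variables (sigma r q p K1 k1 K2 n1 n2 : R).
Hypotheses (K10 : 0 < K1) (K1k1 : K1 < k1) (k1K2 : k1 < K2).
Hypotheses (sigma0 : 0 < sigma) (r0 : 0 < r) (q0 : 0 <= q) (p1 : 1 < p).
Hypotheses (n10 : n1 < 0) (n20 : 0 < n2).
Hypotheses (rn1 : char_poly2 sigma r q n1 = 0) (rn2 : char_poly2 sigma r q n2 = 0).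
Notation c := (ln k1).
Notation F := (free_profile k1 K2 n1 n2).

Implicit Types (a b x y n : R).

Let n21 : 0 < n2 - n1. Proof. by rewrite subr_gt0 (lt_trans n10). Qed.
Let D0 : 0 < K2 - k1. Proof. by rewrite subr_gt0. Qed.

(** The characteristic polynomial equals -q at 1; in factored form this locates n2 relative to 1. *)
Lemma char_at_one : q = sigma ^+ 2 / 2 * ((1 - n1) * (n2 - 1)).
Proof.
have := char_sum n10 n20 rn1 rn2; have := char_prod n10 n20 rn1 rn2; lra.
Qed.

Let A0 : 0 < sigma ^+ 2 / 2. Proof. by rewrite divr_gt0// exprn_gt0. Qed.
Let n11 : 0 < 1 - n1. Proof. by rewrite subr_gt0 (lt_trans n10). Qed.

Lemma root2_ge1 : 1 <= n2.
Proof.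
by rewrite -subr_ge0; have := q0; rewrite char_at_one pmulr_rge0// pmulr_rge0.
Qed.

Lemma root2_gt1 : 0 < q -> 1 < n2.
Proof.
by rewrite -subr_gt0 [in X in X -> _]char_at_one pmulr_rgt0// pmulr_rgt0.
Qed.

Lemma root2_eq1 : q = 0 -> n2 = 1.
Proof.
move=> /eqP; rewrite [in X in X -> _]char_at_one mulf_eq0 gt_eqF//= mulf_eq0 gt_eqF//=.
by rewrite subr_eq0 => /eqP.
Qed.

(** The common coefficient of both exponentials in the derivative of [free_profile], which is why
    the profile starts at [a] with slope 0. It is also the coefficient in [b_uncapped]. *)
Definition slope := (K2 - k1) * n1 * n2 / (n2 - n1).

Lemma slope_lt0 : slope < 0.
Proof.
by rewrite /slope pmulr_llt0 ?invr_gt0// pmulr_llt0// pmulr_rlt0.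
Qed.

Definition profile1 (a x : R) :=
  slope * (expR (n1 * (x - a)) - expR (n2 * (x - a))).

Definition profile2 (a x : R) :=
  slope * (n1 * expR (n1 * (x - a)) - n2 * expR (n2 * (x - a))).

Lemma is_derive_exp_translate (n a x : R) :
  is_derive x 1 (fun y => expR (n * (y - a))) (n * expR (n * (x - a))).
Proof. exact: (is_derive_translate a (is_derive_expRM n)). Qed.

Lemma is_derive_profile a x : is_derive x 1 (F a) (profile1 a x).
Proof.
have d n k := is_derive_scale k (is_derive_exp_translate n a x).
apply: (is_derive_eq (is_derive_scale _ (is_derive_sub (d n1 n2) (d n2 n1)))).
by rewrite /profile1 /slope; field; exact: lt0r_neq0.
Qed.

Lemma is_derive_profile1 a x : is_derive x 1 (profile1 a) (profile2 a x).
Proof.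
have d n := is_derive_exp_translate n a x.
exact: is_derive_scale _ (is_derive_sub (d n1) (d n2)).
Qed.

Lemma continuous_profile a : continuous (F a).
Proof. exact: is_derive_continuous (is_derive_profile a). Qed.

Lemma continuous_profile1 a : continuous (profile1 a).
Proof. exact: is_derive_continuous (is_derive_profile1 a). Qed.

Lemma continuous_profile2 a : continuous (profile2 a).
Proof.
have d n x := is_derive_exp_translate n a x.
apply: (@is_derive_continuous _ _ (fun x => slope *
  (n1 * (n1 * expR (n1 * (x - a))) - n2 * (n2 * expR (n2 * (x - a)))))).
Qed.

Lemma profile_start a : F a a = K2 - k1.
Proof.
by rewrite /free_profile subrr !mulr0 expR0 !mulr1 divfK// lt0r_neq0.
Qed.

Lemma profile1_start a : profile1 a a = 0.
Proof. by rewrite /profile1 subrr !mulr0 subrr mulr0. Qed.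

Lemma profile_shift a x : F a x = F 0 (x - a).
Proof. by rewrite /free_profile subr0. Qed.

Lemma profile1_shift a x : profile1 a x = profile1 0 (x - a).
Proof. by rewrite /profile1 subr0. Qed.

Lemma profile_Lop a x : Lop sigma r q (F a x) (profile1 a x) (profile2 a x) = 0.
Proof.
rewrite /Lop (char_sum n10 n20 rn1 rn2) [in r * _](char_prod n10 n20 rn1 rn2).
by rewrite /profile1 /profile2 /free_profile /slope; field; exact: lt0r_neq0.
Qed.

Lemma profile_incr a x y : a <= x -> x < y -> F a x < F a y.
Proof.
move=> ax xy; apply: (@gtr0_derive1_lt_cc _ (F a) x y) => //.
- move=> z; rewrite in_itv/= => /andP[xz _].
  rewrite derive1E (@derive_val _ _ _ _ _ _ _ (is_derive_profile a z)).
  rewrite /profile1 nmulr_rgt0 ?slope_lt0// subr_lt0 ltr_expR ltr_pM2r.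
    exact: lt_trans n20.
  by rewrite subr_gt0 (le_lt_trans ax).
- by apply: continuous_subspaceT; exact: continuous_profile.
- by rewrite in_itv/= lexx ltW.
- by rewrite in_itv/= lexx ltW.
Qed.

Lemma profile_gt_start a x : a < x -> K2 - k1 < F a x.
Proof. by move=> ax; rewrite -(profile_start a) profile_incr. Qed.

(* As a function of e^x the profile is strictly convex. *)
Lemma profile_above_tangent a b x : F a b = expR b - K1 + K2 - k1 ->
  profile1 a b <= expR b -> x < b -> expR x - K1 + K2 - k1 < F a x.
Proof.
move=> Fb F'b xb; pose G y := F a y - expR y.
have dG y : is_derive y 1 G (profile1 a y - expR y).
  exact: is_derive_sub (is_derive_profile a y) (is_derive_expR y).
have G'neg y : y < b -> profile1 a y - expR y < 0.
  move=> yb; rewrite subr_lt0.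
  (* Divided by e^y, the slope is a negative multiple of a difference of exponentials with rates n1
     - 1 < 0 and n2 - 1 >= 0, hence strictly increasing in y; at b it is at most 1. *)
  have e0 := expR_gt0 (- y); rewrite -(ltr_pM2r e0) expRxMexpNx_1.
  have : profile1 a b * expR (- b) <= 1.
    by rewrite -(expRxMexpNx_1 b) ler_wpM2r ?expR_ge0.
  apply: lt_le_trans; rewrite /profile1 -[ltLHS]mulrA -[ltRHS]mulrA ltr_nM2l ?slope_lt0//.
  rewrite !mulrBl -!expRD ltr_leB// ?ltr_expR ?ler_expR.
    by rewrite -subr_gt0 (_ : _ - _ = (1 - n1) * (b - y));
      [apply: mulr_gt0 => //; rewrite subr_gt0|ring].
  rewrite -subr_ge0 (_ : _ - _ = (n2 - 1) * (b - y)); last by ring.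
  by rewrite mulr_ge0 ?subr_ge0 ?root2_ge1 ?ltW.
have : G b < G x.
  apply: (@ltr0_derive1_lt_cc _ G x b) => //.
  - move=> z; rewrite in_itv/= => /andP[_ zb].
    by rewrite derive1E (@derive_val _ _ _ _ _ _ _ (dG z)) G'neg.
  - exact: continuous_subspaceT (is_derive_continuous dG).
  - by rewrite in_itv/= lexx ltW.
  - by rewrite in_itv/= lexx ltW.
by rewrite /G Fb; lra.
Qed.

End profile.

(** * Gluing the profile to the obstacle *)

Section glued.
Context {R : realType}.
Variables (sigma r q p K1 k1 K2 n1 n2 : R).
Hypotheses (K10 : 0 < K1) (K1k1 : K1 < k1) (k1K2 : k1 < K2).
Hypotheses (sigma0 : 0 < sigma) (r0 : 0 < r) (q0 : 0 <= q) (p1 : 1 < p).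
Hypotheses (n10 : n1 < 0) (n20 : 0 < n2).
Hypotheses (rn1 : char_poly2 sigma r q n1 = 0) (rn2 : char_poly2 sigma r q n2 = 0).
Notation c := (ln k1).
Notation F := (free_profile k1 K2 n1 n2).
Notation F1 := (profile1 k1 K2 n1 n2).
Notation F2 := (profile2 k1 K2 n1 n2).
Notation sol := (strong_solution sigma r q p K1 k1 K2).
Notation mu := (@lebesgue_measure R).
Implicit Types (x y : R).

(** Right of ln k1, [V_capped] continues the profile while [glued] follows the payoff line; this
    lemma passes from one to the other. *)
Lemma strong_solution_ext (V W : R -> R) :
  (forall x, x <= c -> V x = W x) -> sol V -> sol W.
Proof.
move=> VW [bV cV Vc psiV [V1 [V2 [wV geV eqV]]]]; split.
- have [N [Nr HN]] := bV; exists N; split => // M NM x xc.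
  by rewrite /= -VW; [exact: HN|move: xc; rewrite /= in_itv].
- apply: subspace_eq_continuous cV => x; rewrite inE/= in_itv/=; exact: VW.
- by rewrite -VW.
- by move=> x xc; rewrite -VW// psiV.
- have VWo x : `]-oo, c[%classic x -> V x = W x by rewrite /= in_itv/= => /ltW/VW.
  exists V1, V2; split.
  + have [L0 L1 L2 w1 w2] := wV; split => //.
    * move=> K cK KO; rewrite (_ : W \_ K = V \_ K); first exact: L0.
      by apply/funext => x; rewrite !patchE; case: ifPn => // /set_mem/KO/VWo.
    * move=> phi tphi; rewrite -w1//; apply: eq_Rintegral => x /set_mem xO.
      by rewrite VWo.
    * move=> phi tphi; rewrite -w2//; apply: eq_Rintegral => x /set_mem xO.
      by rewrite VWo.
  + move: geV; apply: filterS; first exact: (ae_filter_ringOfSetsType mu).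
    by move=> x /[swap] xc /(_ xc); rewrite VW// ltW.
  + move: eqV; apply: filterS; first exact: (ae_filter_ringOfSetsType mu).
    by move=> x /[swap] xc /(_ xc); rewrite VW// ltW.
Qed.

Variables (a b : R).
Hypotheses (ab : a < b) (bc : b <= c).
Hypothesis Fb : F a b = expR b - K1 + K2 - k1.
Hypothesis F1b : F1 a b <= expR b.
Hypothesis F1b_eq : b < c -> F1 a b = expR b.

(** One candidate for both regimes: if b < c the slopes agree at b, and if b = c only the slope
    inequality is assumed, as nothing beyond the cap counts. *)
Definition glued := piecewise a b (cst (K2 - k1)) (F a) (fun x => expR x - K1 + K2 - k1).

Let k10 : 0 < k1. Proof. exact: lt_trans K1k1. Qed.

(** At [a] the profile equals K2 - k1 and by convexity lies above the payoff line. *)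
Lemma glued_start_lt_strike : expR a < K1.
Proof.
have := profile_above_tangent k1K2 sigma0 q0 n10 n20 rn1 rn2 Fb F1b ab.
rewrite profile_start//; lra.
Qed.

Lemma glued_end_gt_strike : K1 < expR b.
Proof.
have := profile_gt_start k1K2 n10 n20 ab; rewrite Fb; lra.
Qed.

Lemma gluedl x : x <= a -> glued x = K2 - k1.
Proof.
rewrite le_eqVlt => /predU1P[->|xa]; rewrite /glued /piecewise; last by rewrite xa.
by rewrite ltxx (ltW ab) profile_start.
Qed.

Lemma gluedm x : a <= x -> x <= b -> glued x = F a x.
Proof. by move=> ax xb; rewrite /glued /piecewise ltNge ax/= xb. Qed.

Lemma gluedr x : b < x -> glued x = expR x - K1 + K2 - k1.
Proof.
by move=> bx; rewrite /glued /piecewise !ltNge (ltW (lt_trans ab bx))/= leNgt bx.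
Qed.

Lemma psi1l x : x <= a -> psi1 K1 k1 K2 x = K2 - k1.
Proof.
move=> xa; rewrite /psi1 max_r ?add0r// subr_le0.
by rewrite (le_trans _ (ltW glued_start_lt_strike))// ler_expR.
Qed.

Lemma psi1_lt x : a < x -> x < b -> psi1 K1 k1 K2 x < F a x.
Proof.
move=> ax xb; rewrite /psi1 -addrA -ltrBrDr gt_max.
have := profile_gt_start k1K2 n10 n20 ax.
have := profile_above_tangent k1K2 sigma0 q0 n10 n20 rn1 rn2 Fb F1b xb.
by move=> ? ?; apply/andP; split; lra.
Qed.

Lemma psi1r x : b <= x -> psi1 K1 k1 K2 x = expR x - K1 + K2 - k1.
Proof.
move=> bx; rewrite /psi1 max_l// subr_ge0 ltW// (lt_le_trans glued_end_gt_strike)//.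
by rewrite ler_expR.
Qed.

Lemma glued_continuous : continuous glued.
Proof.
(* A single formula replaces the cases: the profile at x clamped to [a, b], plus the increment of
   the exponential beyond b. *)
have -> : glued = fun x => F a (Num.max a (Num.min x b)) + (expR (Num.max x b) - expR b).
  apply/funext => x; have [xa|] := boolP (x <= a).
    have xb : x <= b by rewrite (le_trans xa)// ltW.
    by rewrite gluedl// (min_l xb) (max_l xa) (max_r xb) profile_start// subrr addr0.
  rewrite -ltNge => ax; have [xb|] := boolP (x <= b).
    by rewrite gluedm ?(ltW ax)// (min_l xb) (max_r (ltW ax)) (max_r xb) subrr addr0.
  rewrite -ltNge => bx; rewrite gluedr// (min_r (ltW bx)) (max_r (ltW ab)) (max_l (ltW bx)) Fb; lra.
have cmax (k l : R -> R) : continuous k -> continuous l ->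
    continuous (fun x => Num.max (k x) (l x)).
  by move=> ck cl x; apply: continuous_max; [exact: ck|exact: cl].
have cmin (k l : R -> R) : continuous k -> continuous l ->
    continuous (fun x => Num.min (k x) (l x)).
  by move=> ck cl x; apply: continuous_min; [exact: ck|exact: cl].
have ccst (k : R) : continuous (fun _ : R => k) by move=> x; exact: cvg_cst.
have cid : continuous (fun x : R => x) by move=> x; exact: cvg_id.
have c1 : continuous (F a \o (fun x => Num.max a (Num.min x b))).
  move=> x; apply: continuous_comp; last exact: continuous_profile.
  exact: (cmax _ _ (ccst a) (cmin _ _ cid (ccst b))).
have c2 : continuous (expR \o (fun x => Num.max x b)).
  move=> x; apply: continuous_comp; last exact: continuous_expR.
  exact: (cmax _ _ cid (ccst b)).
by move=> x; apply: cvgD; [exact: c1|apply: cvgB; [exact: c2|exact: cvg_cst]].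
Qed.

Lemma glued_boundary : glued c = K2 - K1.
Proof.
have ec : expR c = k1 by rewrite lnK ?posrE.
have [bltc|cb] := ltP b c; first by rewrite gluedr// ec; lra.
have <- : b = c by apply/le_anti; rewrite bc.
have eb : expR b = k1 by rewrite -ec; congr expR; apply/le_anti; rewrite bc.
by rewrite gluedm ?(ltW ab)// Fb eb; lra.
Qed.

Lemma glued_ge_psi1 x : psi1 K1 k1 K2 x <= glued x.
Proof.
have [xa|ax] := leP x a; first by rewrite gluedl// psi1l.
have [xb|bx] := ltP x b; first by rewrite gluedm ?(ltW ax) ?(ltW xb)// ltW// psi1_lt.
rewrite psi1r//; have [->|xb] := eqVneq x b; first by rewrite gluedm ?(ltW ab)// Fb.
by rewrite gluedr// lt_neqAle eq_sym xb.
Qed.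

(* The tangency at b makes the profile curve upwards at least as much as the
   payoff there, and both have the same value and slope. *)
Lemma payoff_superharmonic : b < c -> 0 <= q * expR b + r * (K2 - k1 - K1).
Proof.
move=> /F1b_eq F1E; have := profile_Lop k1 K2 n10 n20 rn1 rn2 a b.
rewrite -/F1 => L0.
have : 0 <= sigma ^+ 2 / 2 * (F2 a b - F1 a b).
  apply: mulr_ge0; first by rewrite divr_ge0// ltW// exprn_gt0.
  rewrite (_ : _ - _ = - slope k1 K2 n1 n2 * ((1 - n1) * expR (n1 * (b - a)) +
    (n2 - 1) * expR (n2 * (b - a)))); last by rewrite /profile1 /profile2; ring.
  apply: mulr_ge0; first by rewrite oppr_ge0 ltW// slope_lt0.
  have n2ge := root2_ge1 sigma0 q0 n10 n20 rn1 rn2.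
  by apply: addr_ge0; apply: mulr_ge0; rewrite ?expR_ge0// subr_ge0// ltW// (lt_trans n10).
move: L0; rewrite /Lop F1E Fb; lra.
Qed.

Lemma glued_strong_solution : sol glued.
Proof.
have ccst (k : R) : continuous (cst k : R -> R) by move=> x; exact: cvg_cst.
have cE := @continuous_expR R.
have dpay x : is_derive x 1 (fun x => expR x - K1 + K2 - k1) (expR x).
  have H := is_derive_sub (is_derive_add (is_derive_sub (is_derive_expR x)
    (is_derive_cst K1 x 1)) (is_derive_cst K2 x 1)) (is_derive_cst k1 x 1).
  by apply: (is_derive_eq H); rewrite subr0 addr0 subr0.
split.
- have [N0 N00 HN0] := continuous_compact_bounded glued_continuous (@segment_compact _ a c).
  exists N0; split; first exact: num_real.
  move=> M NM x; rewrite /= in_itv/= => xc; rewrite (le_trans _ (ltW NM))//.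
  have [xa|ax] := leP x a.
    rewrite gluedl// -(gluedl (lexx a)) HN0//= in_itv/= lexx/=.
    exact: le_trans (ltW ab) bc.
  by rewrite HN0//= in_itv/= xc ltW.
- exact: continuous_subspaceT glued_continuous.
- exact: glued_boundary.
- by move=> x _; exact: glued_ge_psi1.
- exists (piecewise a b (cst 0) (F1 a) expR), (piecewise a b (cst 0) (F2 a) expR).
  split.
  + apply: piecewise_W2p => //.
    * exact: ltW.
    * by move=> x; exact: is_derive_profile.
    * by move=> x; exact: is_derive_profile1.
    * exact: continuous_profile2.
    * by rewrite profile_start.
    * by rewrite profile1_start.
  + apply: aeW => x xc; rewrite /glued /piecewise.
    have [xa|ax] := ltP x a.
      by rewrite /Lop !mulr0 add0r sub0r opprK mulr_ge0 ?subr_ge0 ?ltW.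
    have [xb|bx] := leP x b; first by rewrite profile_Lop// oppr0.
    (* On the payoff line - L equals q e^x + r (K2 - k1 - K1), nondecreasing in x, so its sign at b
       suffices. *)
    have := payoff_superharmonic (lt_trans bx xc).
    have : q * expR b <= q * expR x by rewrite ler_wpM2l// ler_expR ltW.
    by rewrite /Lop; lra.
  + apply: aeW => x xc; have [xa|ax] := ltP x a.
      by rewrite gluedl ?psi1l ?ltxx ?(ltW xa).
    have [xb|bx] := leP x b; last by rewrite gluedr// psi1r ?ltxx ?(ltW bx).
    by move=> _; rewrite gluedm// /piecewise ltNge ax/= xb profile_Lop ?oppr0.
Qed.

End glued.

(** * The free boundaries *)

Section roots.
Context {R : realType}.
Implicit Types (s t : R).

(** The substitution z = e^t turns ]1, +oo[ into ]0, +oo[, where the intermediate value theorem and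
    strict monotonicity apply. *)
Lemma unique_root_gt1_exp (h k : R -> R) (T : R) : (forall t, h (expR t) = k t) ->
  continuous k -> (forall s t, 0 <= s -> s < t -> k t < k s) ->
  0 < k 0 -> 0 <= T -> k T < 0 -> exists y, unique_root_gt1 h y.
Proof.
move=> hk ck kdecr k0 T0 kT.
have [||t] := @IVT _ k 0 T 0 T0; first exact: continuous_subspaceT.
  by rewrite ge_min le_max (ltW k0) (ltW kT) orbT.
rewrite in_itv/= => /andP[t0 _] kt.
have tgt0 : 0 < t.
  by rewrite lt_neqAle t0 andbT; apply: contraTneq k0 => E; rewrite {2}E kt ltxx.
exists (expR t); split; first by rewrite expR_gt1 hk.
move=> z [z1 hz]; have z0 : 0 < z by rewrite (lt_trans ltr01).
rewrite -[z in RHS]lnK ?posrE//; congr expR.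
have lnz : k (ln z) = 0 by rewrite -hk lnK ?posrE.
have lz0 : 0 < ln z by rewrite ln_gt0.
have [tz|zt|//] := ltgtP t (ln z).
- by have := kdecr _ _ t0 tz; rewrite lnz kt ltxx.
- by have := kdecr _ _ (ltW lz0) zt; rewrite lnz kt ltxx.
Qed.

End roots.

Section thresholds.
Context {R : realType}.
Variables (sigma r q p K1 k1 K2 n1 n2 : R).
Hypotheses (K10 : 0 < K1) (K1k1 : K1 < k1) (k1K2 : k1 < K2).
Hypotheses (sigma0 : 0 < sigma) (r0 : 0 < r) (q0 : 0 <= q) (p1 : 1 < p).
Hypotheses (n10 : n1 < 0) (n20 : 0 < n2).
Hypotheses (rn1 : char_poly2 sigma r q n1 = 0) (rn2 : char_poly2 sigma r q n2 = 0).
Notation c := (ln k1).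
Notation F := (free_profile k1 K2 n1 n2 0).
Notation F1 := (profile1 k1 K2 n1 n2 0).
Notation f := (f_uncapped K1 k1 K2 n1 n2).
Notation g := (g_capped K1 k1 K2 n1 n2).
Implicit Types (s t : R).

Let n21 : 0 < n2 - n1. Proof. by rewrite subr_gt0 (lt_trans n10). Qed.
Let D0 : 0 < K2 - k1. Proof. by rewrite subr_gt0. Qed.

(* f combines value and slope of the profile: f(e^t) = 0 iff the profile
   meets the line e^x - K1 + K2 - k1 tangentially at distance t from its start. *)
Lemma f_uncapped_exp t : f (expR t) = F t - F1 t + (K1 + k1 - K2).
Proof.
rewrite /f_uncapped /free_profile /profile1 /slope !subr0 -!expRM.
by rewrite !(mulrC t); field; exact: lt0r_neq0.
Qed.

Lemma g_capped_exp t : g (expR t) = F t - (K2 - K1).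
Proof. by rewrite /g_capped /free_profile !subr0 -!expRM !(mulrC t). Qed.

Lemma f_uncapped_expE x : f (expR x) = (K2 - k1) / (n2 - n1) *
  (n2 * (1 - n1) * expR (n1 * x) + n1 * (n2 - 1) * expR (n2 * x)) + (K1 + k1 - K2).
Proof. by rewrite /f_uncapped -!expRM !(mulrC x). Qed.

(** The decaying exponential has the positive coefficient n2 (1 - n1); the growing one has n1 (n2 -
    1) <= 0. *)
Lemma f_uncapped_decr s t : 0 <= s -> s < t -> f (expR t) < f (expR s).
Proof.
move=> s0 st; have n2ge := root2_ge1 sigma0 q0 n10 n20 rn1 rn2.
have h1 : expR (n1 * t) < expR (n1 * s) by rewrite ltr_expR ltr_nM2l.
have h2 : expR (n2 * s) < expR (n2 * t) by rewrite ltr_expR ltr_pM2l.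
rewrite !f_uncapped_expE ltrD2r ltr_pM2l ?divr_gt0// ltr_leD//.
  by rewrite ltr_pM2l// mulr_gt0// subr_gt0 (lt_trans n10).
by rewrite ler_wnM2l ?(ltW h2)// mulr_le0_ge0 ?subr_ge0// ltW.
Qed.

Lemma F_start : F 0 = K2 - k1.
Proof. exact: profile_start. Qed.

Lemma g_root_ex : exists y, unique_root_gt1 g y.
Proof.
(* The growing exponential is bounded below by its tangent 1 + n2 t; at T the linear part alone
   contributes K2 - K1. *)
pose T := (K2 - K1) / ((K2 - k1) / (n2 - n1) * - n1 * n2).
have den0 : 0 < (K2 - k1) / (n2 - n1) * - n1 * n2.
  by rewrite mulr_gt0// mulr_gt0 ?divr_gt0// oppr_gt0.
have K21 : 0 < K2 - K1 by rewrite subr_gt0 (lt_trans K1k1).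
have [||||||y [[y1 gy] uy]] := @unique_root_gt1_exp _ (fun z => - g z) (fun t => (K2 - K1) - F t) T.
- by move=> t; rewrite g_capped_exp opprB.
- by move=> t; apply: cvgB; [exact: cvg_cst|exact: continuous_profile].
- by move=> s t s0 st; rewrite ltrD2l ltrN2 profile_incr.
- by rewrite F_start subr_gt0 ltrD2l ltrN2.
- by rewrite divr_ge0// ltW.
- rewrite subr_lt0 /free_profile subr0 mulrBr.
  have e1 : 0 < (K2 - k1) / (n2 - n1) * (n2 * expR (n1 * T)).
    by rewrite mulr_gt0 ?divr_gt0// mulr_gt0 ?expR_gt0.
  have e2 : (K2 - k1) / (n2 - n1) * - n1 * (1 + n2 * T) <=
      (K2 - k1) / (n2 - n1) * - n1 * expR (n2 * T).
    by rewrite ler_wpM2l ?expR_ge1Dx// mulr_ge0 ?oppr_ge0 ?ltW ?divr_gt0.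
  have e3 : (K2 - k1) / (n2 - n1) * - n1 * n2 * T = K2 - K1.
    by rewrite /T mulrC divfK// lt0r_neq0.
  have e4 : 0 < (K2 - k1) / (n2 - n1) * - n1 by rewrite mulr_gt0 ?divr_gt0 ?oppr_gt0.
  by lra.
exists y; split; first by split => //; move: gy => /eqP; rewrite oppr_eq0 => /eqP.
by move=> z [z1 gz]; apply: uy; rewrite gz oppr0.
Qed.

Lemma f_root_ex : uncapped_defined q K1 k1 K2 -> exists y, unique_root_gt1 f y.
Proof.
move=> ud.
have [T T0 fT] : exists2 T, 0 <= T & f (expR T) < 0.
  (* If q > 0 then n2 > 1 and the growing term drives f to -oo. If q = 0 then n2 = 1, that term
     disappears, and f tends to K1 + k1 - K2 < 0. *)
  case: ud => [qpos|[qz Kk]].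
    have n2gt := root2_gt1 sigma0 n10 n20 rn1 rn2 qpos.
    pose G := (K2 - k1) / (n2 - n1).
    have G0 : 0 < G by rewrite divr_gt0.
    pose al := G * (- n1) * (n2 - 1) * n2.
    have al0 : 0 < al.
      by rewrite mulr_gt0// mulr_gt0 ?subr_gt0// mulr_gt0// oppr_gt0.
    (* Bounding the decaying exponential by 1 and the growing one by its tangent gives f(e^T) <= K1
       - al T = -1. *)
    exists ((K1 + 1) / al); first by rewrite divr_ge0 ?ltW// addr_gt0.
    rewrite f_uncapped_expE -/G; set T := _ / _.
    have aT : al * T = K1 + 1 by rewrite mulrC divfK// lt0r_neq0.
    have T0 : 0 <= T by rewrite divr_ge0 ?ltW// addr_gt0.
    have e1 : G * (n2 * (1 - n1)) * expR (n1 * T) <= G * (n2 * (1 - n1)).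
      rewrite ler_piMr ?expR_le1 ?mulr_le0_ge0 ?(ltW n10)//.
      by rewrite mulr_ge0 ?(ltW G0)// mulr_ge0 ?(ltW n20)// subr_ge0 ltW// (lt_trans n10).
    have e2 : G * (- n1) * (n2 - 1) * (1 + n2 * T) <= G * (- n1) * (n2 - 1) * expR (n2 * T).
      rewrite ler_wpM2l ?expR_ge1Dx// mulr_ge0 ?subr_ge0 ?(ltW n2gt)//.
      by rewrite mulr_ge0 ?(ltW G0)// oppr_ge0 ltW.
    have e3 : G * (n2 * (1 - n1)) - G * (- n1) * (n2 - 1) = K2 - k1.
      by rewrite /G; field; exact: lt0r_neq0.
    by move: aT; rewrite /al; lra.
  have n2E := root2_eq1 sigma0 n10 n20 rn1 rn2 qz.
  (* Taking e^(n1 T) = u makes the decaying term half of K2 - K1 - k1, so f(e^T) is minus the other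
     half. *)
  pose u := (K2 - K1 - k1) / (2 * (K2 - k1)).
  have D20 : 0 < 2 * (K2 - k1) by rewrite mulr_gt0.
  have u0 : 0 < u by rewrite divr_gt0//; lra.
  have u1 : u < 1 by rewrite ltr_pdivrMr// mul1r; have := D0; have := K10; lra.
  exists (ln u / n1); first by rewrite mulr_le0// ?invr_le0 ?(ltW n10)// ltW// ln_lt0// u0 u1.
  have eT : expR (n1 * (ln u / n1)) = u by rewrite mulrCA divff ?lt_eqF// mulr1 lnK ?posrE.
  have uD : (K2 - k1) * u = (K2 - K1 - k1) / 2 by rewrite /u; field; exact: lt0r_neq0.
  have -> : f (expR (ln u / n1)) = (K2 - k1) * u + (K1 + k1 - K2).
    rewrite f_uncapped_expE eT n2E subrr mulr0 mul0r addr0 mul1r mulrA divfK//.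
    by rewrite -n2E lt0r_neq0.
  by rewrite uD; lra.
apply: (@unique_root_gt1_exp _ f (fun t => f (expR t)) T) => //.
- under eq_fun do rewrite f_uncapped_exp.
  move=> t; apply: cvgD; last exact: cvg_cst.
  by apply: cvgB; [exact: continuous_profile|exact: continuous_profile1].
- exact: f_uncapped_decr.
- by rewrite f_uncapped_exp F_start profile1_start; have := K10; lra.
Qed.

Lemma root_exp (h : R -> R) y : unique_root_gt1 h y ->
  exists t, [/\ 0 < t, y = expR t & h (expR t) = 0].
Proof.
move=> [[y1 hy] _]; exists (ln y).
have E : expR (ln y) = y by rewrite lnK// posrE (lt_trans ltr01).
by rewrite ln_gt0// E.
Qed.

(** The definition of b is the slope half of smooth fit: the profile at distance t from its start
    has the slope e^b of the payoff. *)
Lemma b_uncapped_exp t : 0 < t ->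
  expR (b_uncapped k1 K2 n1 n2 (expR t)) = F1 t.
Proof.
move=> t0; have E : (K2 - k1) * n1 * n2 / (n2 - n1) * (expR t `^ n1 - expR t `^ n2) = F1 t.
  by rewrite /profile1 /slope !subr0 -!expRM !(mulrC t).
rewrite /b_uncapped E lnK// posrE /profile1 subr0 nmulr_rgt0 ?slope_lt0//.
by rewrite subr_lt0 ltr_expR ltr_pM2r// (lt_trans n10).
Qed.

Lemma a_uncapped_exp t :
  a_uncapped k1 K2 n1 n2 (expR t) = b_uncapped k1 K2 n1 n2 (expR t) - t.
Proof. by rewrite /a_uncapped -expRN -expRD expRK. Qed.

Lemma a_capped_exp t : a_capped k1 (expR t) = c - t.
Proof.
rewrite /a_capped -expRN lnM ?posrE ?expR_gt0 ?expRK//.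
by rewrite (lt_trans K10).
Qed.

Lemma strong_solution_unique (V : R -> R) : strong_solution sigma r q p K1 k1 K2 V ->
  unique_strong_solution sigma r q p K1 k1 K2 V.
Proof.
move=> sV; split => // W sW x xc; apply/le_anti/andP; split.
  exact: (comparison sigma0 p1 n10 n20 rn1 rn2 sW sV).
exact: (comparison sigma0 p1 n10 n20 rn1 rn2 sV sW).
Qed.

(** The choice of b matches slopes; f = 0 then matches values. *)
Lemma uncapped_solution yinf : unique_root_gt1 f yinf ->
  b_uncapped k1 K2 n1 n2 yinf <= c ->
  unique_strong_solution sigma r q p K1 k1 K2 (V_uncapped K1 k1 K2 n1 n2 yinf).
Proof.
move=> /root_exp[t [t0 -> ft]] bc; apply: strong_solution_unique.
have eb := b_uncapped_exp t0.
pose b := b_uncapped k1 K2 n1 n2 (expR t).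
have ab : a_uncapped k1 K2 n1 n2 (expR t) = b - t := a_uncapped_exp t.
have Fb1 : profile1 k1 K2 n1 n2 (b - t) b = expR b.
  by rewrite profile1_shift opprB addrC subrK eb.
apply: (@glued_strong_solution _ sigma r q p K1 k1 K2 n1 n2 K10 K1k1 k1K2 sigma0 r0 q0 p1
  n10 n20 rn1 rn2 (a_uncapped k1 K2 n1 n2 (expR t)) b) => //; rewrite ab.
- by rewrite gtrBl.
- rewrite profile_shift opprB addrC subrK eb.
  by move: ft; rewrite f_uncapped_exp; lra.
- by rewrite Fb1.
- by move=> _.
Qed.

(** g = 0 is the boundary value at ln k1. Given it, f(y) is k1 minus the slope of the profile there,
    so its sign is the slope inequality required of [glued] with b = ln k1. *)
Lemma capped_solution y : unique_root_gt1 g y -> 0 <= f y ->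
  unique_strong_solution sigma r q p K1 k1 K2 (V_capped k1 K2 n1 n2 y) /\
  coincidence_set K1 k1 K2 (V_capped k1 K2 n1 n2 y) =
    `]-oo, a_capped k1 y] `|` [set c].
Proof.
move=> /root_exp[t [t0 -> gt]] ft.
have ec : expR c = k1 by rewrite lnK// posrE (lt_trans K10).
have aE := a_capped_exp t.
have ac : c - t < c by rewrite gtrBl.
have Fc : free_profile k1 K2 n1 n2 (c - t) c = expR c - K1 + K2 - k1.
  rewrite profile_shift opprB addrC subrK ec.
  by move: gt; rewrite g_capped_exp; lra.
have F1c : profile1 k1 K2 n1 n2 (c - t) c <= expR c.
  rewrite profile1_shift opprB addrC subrK ec.
  by move: ft gt; rewrite g_capped_exp f_uncapped_exp; lra.
pose V := glued K1 k1 K2 n1 n2 (c - t) c.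
have VE x : x <= c -> V x = V_capped k1 K2 n1 n2 (expR t) x.
  by move=> xc; rewrite /V /glued /piecewise /V_capped aE xc.
split.
  apply/strong_solution_unique/(strong_solution_ext VE).
  apply: (@glued_strong_solution _ sigma r q p K1 k1 K2 n1 n2) => //.
  by rewrite ltxx.
have psil x := @psi1l _ sigma r q K1 k1 K2 n1 n2 k1K2 sigma0 q0 n10 n20 rn1 rn2 _ _ ac Fc F1c x.
have psilt x := @psi1_lt _ sigma r q K1 k1 K2 n1 n2 k1K2 sigma0 q0 n10 n20 rn1 rn2 _ _ Fc F1c x.
apply/seteqP; split=> x; rewrite /coincidence_set /= in_itv/= aE.
  move=> [xc]; rewrite -VE// => Vx.
  have [xa|ax] := leP x (c - t); [by left|right].
  apply/eqP; rewrite eq_le xc leNgt; apply/negP => xltc.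
  by have := psilt x ax xltc; rewrite -Vx /V gluedm ?(ltW ax)// ltxx.
move=> [xa|->].
  have xc : x <= c by rewrite (le_trans xa)// ltW.
  by rewrite -VE// psil// /V gluedl.
by split => //; rewrite -VE// /V (gluedm _ _ _ _ _ (ltW ac))// Fc (psi1r k1K2 n10 n20 ac Fc).
Qed.

Lemma f_ge0_degenerate y : q = 0 -> K2 <= K1 + k1 -> 1 < y -> 0 <= f y.
Proof.
move=> qz Kk y1; have n2E := root2_eq1 sigma0 n10 n20 rn1 rn2 qz.
rewrite -[y]lnK ?posrE ?(lt_trans ltr01)// f_uncapped_expE n2E subrr !(mulr0, mul0r) addr0 mul1r.
have n11 : 0 < 1 - n1 by rewrite subr_gt0 (lt_trans n10).
by rewrite addr_ge0 ?subr_ge0// mulr_ge0 ?divr_ge0 ?mulr_ge0 ?expR_ge0 ?ltW.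
Qed.

(** With yinf = e^s and y = e^t, a boundary b beyond the cap means that the slope at s exceeds k1.
    Then f = 0 makes the value at s exceed K2 - K1, the value at t; hence t < s, and f decreases. *)
Lemma f_ge0_below_root y yinf : unique_root_gt1 f yinf -> unique_root_gt1 g y ->
  c < b_uncapped k1 K2 n1 n2 yinf -> 0 <= f y.
Proof.
move=> /root_exp[s [s0 -> fs]] /root_exp[t [t0 -> gt]] cb.
have F1s : k1 < F1 s.
  by rewrite -b_uncapped_exp// -[ltLHS]lnK ?ltr_expR// posrE (lt_trans K10).
have Fts : F t < F s.
  by move: fs gt; rewrite f_uncapped_exp g_capped_exp; lra.
have ts : t < s.
  rewrite ltNge; apply/negP; rewrite le_eqVlt => /predU1P[E|st].
    by move: Fts; rewrite E ltxx.
  by have := profile_incr k1K2 n10 n20 (ltW s0) st; rewrite ltNge (ltW Fts).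
by rewrite -fs ltW// f_uncapped_decr// ltW.
Qed.

End thresholds.

Theorem theorem5p3 (R : realType) (sigma r q p K1 k1 k2 K2 n1 n2 : R)
  (hK1 : 0 < K1) (hK1k1 : K1 < k1) (hk1k2 : k1 < k2) (hk2K2 : k2 < K2)
  (hsigma : 0 < sigma) (hr : 0 < r) (hq : 0 <= q) (hp : 1 < p)
  (hn1 : n1 < 0) (hn2 : 0 < n2)
  (root_n1 : char_poly2 sigma r q n1 = 0)
  (root_n2 : char_poly2 sigma r q n2 = 0) :
  (uncapped_defined q K1 k1 K2 ->
     exists yinf : R,
       unique_root_gt1 (f_uncapped K1 k1 K2 n1 n2) yinf /\
       (b_uncapped k1 K2 n1 n2 yinf <= ln k1 ->
        unique_strong_solution sigma r q p K1 k1 K2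
          (V_uncapped K1 k1 K2 n1 n2 yinf)))
  /\
  ((q = 0 /\ K2 <= K1 + k1) \/
   (uncapped_defined q K1 k1 K2 /\
    exists yinf : R,
      unique_root_gt1 (f_uncapped K1 k1 K2 n1 n2) yinf /\
      ln k1 < b_uncapped k1 K2 n1 n2 yinf) ->
     exists y : R,
       [/\ unique_root_gt1 (g_capped K1 k1 K2 n1 n2) y,
           unique_strong_solution sigma r q p K1 k1 K2
             (V_capped k1 K2 n1 n2 y) &
           coincidence_set K1 k1 K2 (V_capped k1 K2 n1 n2 y)
             = `]-oo, a_capped k1 y] `|` [set ln k1]]).
Proof.
have k1K2 : k1 < K2 by exact: lt_trans hk2K2.
split=> [ud|ud].
  have [yinf yinfP] := f_root_ex hK1 k1K2 hsigma hq hn1 hn2 root_n1 root_n2 ud.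
  exists yinf; split=> // bk1.
  exact: (uncapped_solution hK1 hK1k1 k1K2 hsigma hr hq hp hn1 hn2 root_n1 root_n2 yinfP bk1).
have [y yP] := g_root_ex hK1k1 k1K2 hn1 hn2.
have fy : 0 <= f_uncapped K1 k1 K2 n1 n2 y.
  case: ud => [[q0 Kk]|[_ [yinf [yinfP bk1]]]].
    have [[y1 _] _] := yP.
    exact: (f_ge0_degenerate k1K2 hsigma hn1 hn2 root_n1 root_n2 q0 Kk y1).
  exact: (f_ge0_below_root hK1 hK1k1 k1K2 hsigma hq hn1 hn2 root_n1 root_n2 yinfP yP bk1).
have [sol coin] := capped_solution hK1 hK1k1 k1K2 hsigma hr hq hp hn1 hn2 root_n1 root_n2 yP fy.
by exists y; split.
Qed.
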